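(* Let the delay $r>0$, $\boldsymbol f(\cdot)$ and $M$ be as in the context and let $\{\alpha_i\}_{i=1}^{2+d}\subset\mathbb R$, $d\in\mathbb N$, be given. Suppose there exist $\acute P\in\mathbb S^n$, an invertible $X\in\mathbb R^{n\times n}$, $V\in\mathbb R^{p\times n}$, $\acute Q\in\mathbb R^{n\times dn}$, $\acute R\in\mathbb S^{dn}$, $\acute S,\acute U\in\mathbb S^n$ and $\varkappa_1,\varkappa_2>0$ such that $$\begin{bmatrix}\acute P&\acute Q\\ *&\acute R+\mathsf F\otimes\acute S\end{bmatrix}\succ0,\ \ \acute S\succ0,\ \ \acute U\succ0,\qquad\begin{bmatrix}I&-I-\varkappa_1\mathbf F_\Delta^\top\mathbf J_2&\varkappa_1\mathbf F_\Delta^\top\\ *&I-\varkappa_1\mathbf J_3&\mathsf O\\ *&*&\varkappa_1\mathbf J_1\end{bmatrix}\succ0,$$ $$\begin{bmatrix}\acute{\boldsymbol\Theta}&\acute{\mathbf G}+\varkappa_2\acute{\mathbf H}^\top\mathbf J_2&\varkappa_2\acute{\mathbf H}^\top\\ *&\varkappa_2\mathbf F_\Delta^\top\mathbf J_2+\varkappa_2\mathbf J_2^\top\mathbf F_\Delta+\varkappa_2\mathbf J_3&\varkappa_2\mathbf F_\Delta^\top\\ *&*&-\varkappa_2\mathbf J_1\end{bmatrix}\prec0,$$ where $\mathsf F^{-1}=\int_{-r}^0\boldsymbol f\boldsymbol f^\top d\tau$, $\mathbf F_\Delta=\bigoplus_{i=1}^{14}F_i$, $\mathbf J_1=\bigoplus_{i=1}^{14}\Xi_i$,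 $\mathbf J_2=\bigoplus_{i=1}^{14}\Lambda_i$, $\mathbf J_3=\bigoplus_{i=1}^{14}\Gamma_i$, $$\acute{\boldsymbol\Theta}=\mathsf{Sy}\left(\begin{bmatrix}I_n\\ \mathsf{Col}_{i=1}^{2+d}\alpha_iI_n\\ \mathsf O_{(q+m),n}\end{bmatrix}\begin{bmatrix}-X&\acute{\boldsymbol\Pi}\end{bmatrix}\right)+\begin{bmatrix}\mathsf O_n&\acute{\mathbf P}\\ *&\acute{\boldsymbol\Phi}\end{bmatrix},$$ $\acute{\mathbf P}=[\acute P\ \mathsf O_n\ \acute Q\ \mathsf O_{n,q}\ \mathsf O_{n,m}]$, $\acute{\boldsymbol\Pi}=[\mathbf A[(I_{2+d}\otimes X)\oplus I_q]+\mathbf B_1[(I_{2+d}\otimes V)\oplus\mathsf O_q]\ \ \mathsf O_{n,m}]$, $$\acute{\boldsymbol\Phi}=\mathsf{Sy}\left(\begin{bmatrix}\acute Q\\ \mathsf O_{n,dn}\\ \acute R\\ \mathsf O_{(q+m),dn}\end{bmatrix}\begin{bmatrix}\mathbf F&\mathsf O_{dn,m}\end{bmatrix}\right)+(\acute S+r\acute U)\oplus(-\acute S)\oplus(-\mathsf F\otimes\acute U)\oplus(-J_3)\oplus J_1+\mathsf{Sy}\left(\begin{bmatrix}\mathsf O_{(2n+dn),m}\\ -J_2^\top\\ \widetilde J\end{bmatrix}\begin{bmatrix}\acute{\boldsymbol\Sigma}&\mathsf O_m\end{bmatrix}\right),$$ $\acute{\boldsymbol\Sigma}=[C_1X+B_4V\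 \ C_2X+B_5V\ \ C_3(I_d\otimes X)+B_6(I_d\otimes V)\ \ D_2]$, $\mathbf F=[F(0)\ \ -F(-r)\ \ -M\otimes I_n\ \ \mathsf O_{dn,q}]$, and $$\acute{\mathbf G}=\begin{bmatrix}I_n&\mathsf O_{n,m}\\ \mathsf{Col}_{i=1}^{d+2}\alpha_iI_n&\mathsf O_{(d+2)n,m}\\ \mathsf O_{q,n}&-J_2^\top\\ \mathsf O_{m,n}&\widetilde J\end{bmatrix}\begin{bmatrix}\mathsf{Row}_{i=1}^7G_i&\mathsf O\\ \mathsf O&\mathsf{Row}_{i=8}^{14}G_i\end{bmatrix},$$ $$\acute{\mathbf H}=\begin{bmatrix}\begin{bmatrix}H_1X\\ H_2V\end{bmatrix}\oplus\begin{bmatrix}H_3X\\ H_4V\end{bmatrix}\oplus\begin{bmatrix}H_5(I_d\otimes X)\\ H_6(I_d\otimes V)\end{bmatrix}\oplus H_7\\ \begin{bmatrix}H_8X\\ H_9V\end{bmatrix}\oplus\begin{bmatrix}H_{10}X\\ H_{11}V\end{bmatrix}\oplus\begin{bmatrix}H_{12}(I_d\otimes X)\\ H_{13}(I_d\otimes V)\end{bmatrix}\oplus H_{14}\end{bmatrix}\begin{bmatrix}\mathsf O_{(2n+dn+q),n}&I_{2n+dn+q}&\mathsf O_{(2n+dn+q),m}\end{bmatrix}.$$ Then, with $K=VX^{-1}$, the uncertain closed-loop system (CLS) of the context with supply rate function $\mathsf s$ is robustly dissipative subject to the uncertainty constraints, and the trivial solution $\boldsymbol x(t)\equiv\mathbf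 0_n$ of the uncertain CLS with $\boldsymbol w(t)\equiv\mathbf 0_q$ is robustly globally asymptotically stable subject to the uncertainty constraints.
   Context: Notation: $\mathsf{Sy}(X)=X+X^\top$; $\mathsf{Row}_iX_i$, $\mathsf{Col}_iX_i$ concatenate horizontally, vertically; $\oplus$ is block-diagonal sum; $\otimes$ Kronecker product; $\mathbb S^n$ = real symmetric $n\times n$ matrices; $\mathsf O_{n,m}$ zero matrix, $\mathsf O_n=\mathsf O_{n,n}$; unlabelled $I,\mathsf O$ have compatible sizes; $*$ denotes blocks determined by symmetry. Functions: $\boldsymbol f\in C^1([-r,0];\mathbb R^d)$ satisfies $\boldsymbol f'(\tau)=M\boldsymbol f(\tau)$, $M\in\mathbb R^{d\times d}$, and $\int_{-r}^0\boldsymbol f\boldsymbol f^\top d\tau\succ0$; $F(\tau)=\boldsymbol f(\tau)\otimes I_n$. Uncertain open-loop system, $t\ge t_0$: $\dot{\boldsymbol x}(t)=\grave A_1\boldsymbol x(t)+\grave A_2\boldsymbol x(t-r)+\int_{-r}^0\grave A_3F(\tau)\boldsymbol x(t+\tau)d\tau+\grave B_1\boldsymbol u(t)+\grave B_2\boldsymbol u(t-r)+\int_{-r}^0\grave B_3(\boldsymbol f(\tau)\otimes I_p)\boldsymbol u(t+\tau)d\tau+\grave D_1\boldsymbol w(t)$, $\boldsymbol z(t)=\grave C_1\boldsymbol x(t)+\grave C_2\boldsymbol x(t-r)+\int_{-r}^0\grave C_3F(\tau)\boldsymbol x(t+\tau)d\tau+\grave B_4\boldsymbol u(t)+\grave B_5\boldsymbol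 u(t-r)+\int_{-r}^0\grave B_6(\boldsymbol f(\tau)\otimes I_p)\boldsymbol u(t+\tau)d\tau+\grave D_2\boldsymbol w(t)$, $\boldsymbol x\in\mathbb R^n,\boldsymbol u\in\mathbb R^p,\boldsymbol z\in\mathbb R^m$, $\boldsymbol w\in\mathcal L^2([t_0,\infty);\mathbb R^q)$, $\boldsymbol x(t_0+\theta)=\boldsymbol\phi(\theta)$ on $[-r,0]$ with $\boldsymbol\phi$ continuous, where $[\grave A_1\ \grave B_1\ \grave A_2\ \grave B_2\ \grave A_3\ \grave B_3\ \grave D_1]=[A_1\ B_1\ A_2\ B_2\ A_3\ B_3\ D_1]+\mathsf{Row}_{i=1}^7G_i(I-\Delta_iF_i)^{-1}\Delta_iH_i$, $[\grave C_1\ \grave B_4\ \grave C_2\ \grave B_5\ \grave C_3\ \grave B_6\ \grave D_2]=[C_1\ B_4\ C_2\ B_5\ C_3\ B_6\ D_2]+\mathsf{Row}_{i=8}^{14}G_i(I-\Delta_iF_i)^{-1}\Delta_iH_i$, with given $G_i,F_i,H_i$ and uncertainties constrained, for $i=1,\dots,14$, by $\begin{bmatrix}I\\ \Delta_i\end{bmatrix}^\top\begin{bmatrix}\Xi_i^{-1}&\Lambda_i\\ *&\Gamma_i\end{bmatrix}\begin{bmatrix}I\\ \Delta_i\end{bmatrix}\succeq0$, with given $\Xi_i\succ0$, $\Gamma_i\preceq0$, $\Lambda_i$. The nominal matrices are collected as $\mathbf A=[A_1\ A_2\ A_3\ D_1]$, $\mathbf B_1=[B_1\ B_2\ B_3\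 \mathsf O_{n,q}]$. The uncertain CLS is obtained from the open-loop system by $\boldsymbol u(t)=K\boldsymbol x(t)$, $K\in\mathbb R^{p\times n}$, also applied to the delayed values, so that $\boldsymbol u(t-r)=K\boldsymbol x(t-r)$ and $\boldsymbol u(t+\tau)=K\boldsymbol x(t+\tau)$. Supply rate: $\mathsf s(\boldsymbol z,\boldsymbol w)=\begin{bmatrix}\boldsymbol z\\ \boldsymbol w\end{bmatrix}^\top\begin{bmatrix}\widetilde J^\top J_1^{-1}\widetilde J&J_2\\ *&J_3\end{bmatrix}\begin{bmatrix}\boldsymbol z\\ \boldsymbol w\end{bmatrix}$, $J_1\in\mathbb S^m$, $J_1^{-1}\prec0$, $\widetilde J\in\mathbb R^{m\times m}$, $J_2\in\mathbb R^{m\times q}$, $J_3\in\mathbb S^q$. Dissipative: there is a differentiable $\mathsf v:C([-r,0];\mathbb R^n)\to\mathbb R_{\ge0}$ with $\frac d{dt}\mathsf v(\mathbf x_t(\cdot))-\mathsf s(\boldsymbol z(t),\boldsymbol w(t))\le0$ for all $t\ge t_0$, $\mathbf x_t(\theta)=\boldsymbol x(t+\theta)$. ''Robustly ... subject to the uncertainty constraints'' means for all $\Delta_i$, $i=1,\dots,14$, satisfying $\begin{bmatrix}I\\ \Delta_i\end{bmatrix}^\top\begin{bmatrix}\Xi_i^{-1}&\Lambda_i\\ *&\Gamma_i\end{bmatrix}\begin{bmatrix}I\\ \Delta_i\end{bmatrix}\succeq0$ (the inverses $(I-\Delta_iF_i)^{-1}$ being well defined). *)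

(* Defs.v *)
From HB Require Import structures.
From mathcomp Require Import all_boot all_order all_algebra mxtens.
From mathcomp Require Import all_classical all_reals all_analysis.
Set Implicit Arguments. Unset Strict Implicit. Unset Printing Implicit Defensive.
Import Order.TTheory GRing.Theory Num.Theory.
Import numFieldNormedType.Exports.
Local Open Scope classical_set_scope.
Local Open Scope ring_scope.

(* [history r n] is the Banach space C([-r, 0]; R^n) with the supremum norm. *)

Section history.
Variables (R : realType) (r : R) (n : nat).

Record history := History {
  history_fun :> `[- r, 0]%classic -> 'cV[R]_n;
  _ : `[< continuous history_fun >] }.

HB.instance Definition _ := [isSub for history_fun].
HB.instance Definition _ := [Choice of history by <:].

Lemma continuous_submod_closed : submod_closed
  [pred f : `[- r, 0]%classic -> 'cV[R]_n | `[< continuous f >]].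
Proof.
split=> [|a f g].
  by apply: asboolT => t; exact: cst_continuous.
rewrite !inE => cf cg t.
apply: (@continuousD _ _ _ (a *: f) g t); last exact: cg.
by apply: continuousZl_tmp; exact: cf.
Qed.

HB.instance Definition _ := GRing.SubChoice_isSubLmodule.Build
  R _ _ history continuous_submod_closed.

Implicit Types phi psi : history.

Definition history_norm phi : R := sup (range (fun t => `|phi t|)).

Lemma history_norm_ubound phi t : `|phi t| <= history_norm phi.
Proof.
apply: ub_le_sup; last by exists t.
have /asboolP/subspace_valL_continuousP cphi := valP phi.
have /compact_bounded [M [_ Mb]] :=
  continuous_compact cphi (@segment_compact R (- r) 0).
exists (M + 1) => _ [s _ <-]; apply: (Mb (M + 1)); first by rewrite ltrDl.
exists (val s); first exact: set_valP.
exact: (congr1 (fun g => g s) (valLK point (val phi))).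
Qed.

Lemma history_norm_le phi (M : R) :
  0 <= M -> (forall t, `|phi t| <= M) -> history_norm phi <= M.
Proof.
move=> M0 phiM; rewrite /history_norm; set E := (X in sup X).
have [->|E0] := eqVneq E set0; first by rewrite sup0.
by apply: ge_sup => [|_ [t _ <-]//]; exact/set0P.
Qed.

Lemma history_norm_ge0 phi : 0 <= history_norm phi.
Proof.
rewrite /history_norm; set E := (X in sup X).
have [->|/set0P[_ [t _ _]]] := eqVneq E set0; first by rewrite sup0.
exact: le_trans (history_norm_ubound phi t).
Qed.

Lemma history_normD phi psi :
  history_norm (phi + psi) <= history_norm phi + history_norm psi.
Proof.
apply: history_norm_le => [|t]; first by rewrite addr_ge0 ?history_norm_ge0.
by rewrite (le_trans (ler_normD (phi t) (psi t))) ?lerD ?history_norm_ubound.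
Qed.

Lemma history_normZ (a : R) phi :
  history_norm (a *: phi) = `|a| * history_norm phi.
Proof.
have le b psi : history_norm (b *: psi) <= `|b| * history_norm psi.
  apply: history_norm_le => [|t]; first by rewrite mulr_ge0 ?history_norm_ge0.
  by rewrite [_ t]/(b *: psi t) normrZ ler_wpM2l ?history_norm_ubound.
apply/le_anti; rewrite le /=; have [->|a0] := eqVneq a 0.
  by rewrite normr0 mul0r history_norm_ge0.
rewrite -ler_pdivlMl ?normr_gt0// -normfV.
by rewrite -{1}[phi](scalerK a0).
Qed.

Lemma history_norm0_eq0 phi : history_norm phi = 0 -> phi = 0.
Proof.
move=> phi0; apply/val_inj/funext => t; apply/eqP.
rewrite -normr_le0; apply: le_trans (history_norm_ubound phi t) _.
by rewrite phi0.
Qed.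

HB.instance Definition _ := Lmodule_isNormed.Build
  R history history_normD history_normZ history_norm0_eq0.

End history.

(* The element x_t(theta) = x (t + theta) of C([-r, 0]; R^n). The default value
   0 is only taken when x is not continuous on [t - r, t]. *)
Definition segment_of (R : realType) (r : R) (n : nat) (x : R -> 'cV[R]_n)
    (t : R) : history r n :=
  insubd (0 : history r n)
    (fun theta : `[- r, 0]%classic => x (t + set_val theta)).

Section calculus.
Context {R : realType}.

(* One-sided at the endpoints of D when D is an interval. *)
Definition has_derivative_on {V : normedModType R} (D : set R) (g : R -> V)
    (t : R) (l : V) : Prop :=
  (s - t)^-1 *: (g s - g t) @[s --> within D t^'] --> l.

Definition mx_integral {k l} (a b : R) (g : R -> 'M[R]_(k, l)) : 'M[R]_(k, l) :=
  \matrix_(i, j) \int[lebesgue_measure]_(t in `[a, b]) g t i j.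

Definition square_integrable_on {k} (D : set R) (w : R -> 'cV[R]_k) : Prop :=
  forall i, measurable_fun D (fun t => w t i 0) /\
    lebesgue_measure.-integrable D (fun t => ((w t i 0) ^+ 2)%:E).

End calculus.

Section matrices.
Context {R : realType}.

Definition quad_form {k} (A : 'M[R]_k) (x : 'cV[R]_k) : R := (x^T *m A *m x) 0 0.

Definition posdef {k} (A : 'M[R]_k) : Prop :=
  A^T = A /\ forall x : 'cV[R]_k, x != 0 -> 0 < quad_form A x.
Definition possemidef {k} (A : 'M[R]_k) : Prop :=
  A^T = A /\ forall x : 'cV[R]_k, 0 <= quad_form A x.
Definition negdef {k} (A : 'M[R]_k) : Prop := posdef (- A).
Definition negsemidef {k} (A : 'M[R]_k) : Prop := possemidef (- A).

Definition Sy {k} (A : 'M[R]_k) : 'M[R]_k := A + A^T.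

Definition dsum {k1 l1 k2 l2} (A : 'M[R]_(k1, l1)) (B : 'M[R]_(k2, l2)) :
  'M[R]_(k1 + k2, l1 + l2) := block_mx A 0 0 B.

Definition sym2 {k1 k2} (A : 'M[R]_k1) (B : 'M[R]_(k1, k2)) (D : 'M[R]_k2) :
  'M[R]_(k1 + k2) := block_mx A B B^T D.

Definition sym3 {k1 k2 k3} (A11 : 'M[R]_k1) (A12 : 'M[R]_(k1, k2))
    (A13 : 'M[R]_(k1, k3)) (A22 : 'M[R]_k2) (A23 : 'M[R]_(k2, k3))
    (A33 : 'M[R]_k3) : 'M[R]_(k1 + (k2 + k3)) :=
  sym2 A11 (row_mx A12 A13) (sym2 A22 A23 A33).

(* v (x) I_k for a column vector v; the cast is along 1 * k = k. *)
Definition tensI {l} (v : 'cV[R]_l) (k : nat) : 'M[R]_(l * k, k) :=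
  castmx (erefl, mul1n k) (v *t (1%:M : 'M[R]_k)).

End matrices.

Local Notation "A ⊕ B" := (dsum A B) (at level 50, left associativity).

Record plant (R : realType) (n m p q d : nat) := Plant {
  A1 : 'M[R]_n; A2 : 'M[R]_n; A3 : 'M[R]_(n, d * n);
  B1 : 'M[R]_(n, p); B2 : 'M[R]_(n, p); B3 : 'M[R]_(n, d * p);
  D1 : 'M[R]_(n, q);
  C1 : 'M[R]_(m, n); C2 : 'M[R]_(m, n); C3 : 'M[R]_(m, d * n);
  B4 : 'M[R]_(m, p); B5 : 'M[R]_(m, p); B6 : 'M[R]_(m, d * p);
  D2 : 'M[R]_(m, q) }.

Record supply_rate (R : realType) (m q : nat) := SupplyRate {
  J1 : 'M[R]_m; Jt : 'M[R]_m; J2 : 'M[R]_(m, q); J3 : 'M[R]_q }.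

Definition supply {R : realType} {m q} (s : supply_rate R m q)
    (z : 'cV[R]_m) (w : 'cV[R]_q) : R :=
  quad_form (sym2 ((Jt s)^T *m invmx (J1 s) *m Jt s) (J2 s) (J3 s)) (col_mx z w).

(* Sizes of the i-th perturbed block, in the order
   A1 B1 A2 B2 A3 B3 D1, C1 B4 C2 B5 C3 B6 D2; the index i : 'I_14 starts
   at 0, so that [ix k] is the k-th uncertainty, 1 <= k <= 14. *)
Definition block_rows (n m : nat) (i : 'I_14) : nat :=
  if (i < 7)%N then n else m.
Definition block_cols (n p q d : nat) (i : 'I_14) : nat :=
  nth 0%N [:: n; p; n; p; d * n; d * p; q; n; p; n; p; d * n; d * p; q]%N i.
Local Notation ix k := (@Ordinal 14 k.-1 isT).

Record uncertainty (R : realType) (n m p q d : nat) := Uncertainty {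
  usize : 'I_14 -> nat;
  ysize : 'I_14 -> nat;
  uG : forall i, 'M[R]_(block_rows n m i, usize i);
  uF : forall i, 'M[R]_(ysize i, usize i);
  uH : forall i, 'M[R]_(ysize i, block_cols n p q d i);
  uXi : forall i, 'M[R]_(ysize i);
  uLambda : forall i, 'M[R]_(ysize i, usize i);
  uGamma : forall i, 'M[R]_(usize i) }.

Section uncertain_plant.
Context {R : realType} {n m p q d : nat}.
Variable U : uncertainty R n m p q d.

Definition perturbation : Type := forall i, 'M[R]_(usize U i, ysize U i).

Implicit Types Delta : perturbation.

Definition admissible Delta : Prop := forall i,
  possemidef ((col_mx 1%:M (Delta i))^T
    *m sym2 (invmx (uXi U i)) (uLambda U i) (uGamma U i)
    *m col_mx 1%:M (Delta i)).

Definition well_posed Delta : Prop :=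
  forall i, 1%:M - Delta i *m uF U i \in unitmx.

(* Both the existence of the inverses (I - Delta_i F_i)^-1 and the property
   are required of every admissible Delta. *)
Definition robustly (Q : perturbation -> Prop) : Prop :=
  forall Delta, admissible Delta -> well_posed Delta /\ Q Delta.

Definition block_error Delta i : 'M[R]_(block_rows n m i, block_cols n p q d i) :=
  uG U i *m invmx (1%:M - Delta i *m uF U i) *m Delta i *m uH U i.

Definition perturb (P : plant R n m p q d) Delta : plant R n m p q d :=
  let E := block_error Delta in
  {| A1 := A1 P + E (ix 1); B1 := B1 P + E (ix 2); A2 := A2 P + E (ix 3);
     B2 := B2 P + E (ix 4); A3 := A3 P + E (ix 5); B3 := B3 P + E (ix 6);
     D1 := D1 P + E (ix 7);
     C1 := C1 P + E (ix 8); B4 := B4 P + E (ix 9); C2 := C2 P + E (ix 10);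
     B5 := B5 P + E (ix 11); C3 := C3 P + E (ix 12); B6 := B6 P + E (ix 13);
     D2 := D2 P + E (ix 14) |}.

End uncertain_plant.

Section delay_system.
Context {R : realType} {n m p q d : nat}.
Variables (r : R) (f : R -> 'cV[R]_d) (P : plant R n m p q d).

Definition state_rhs (x : R -> 'cV[R]_n) (u : R -> 'cV[R]_p)
    (w : R -> 'cV[R]_q) (t : R) : 'cV[R]_n :=
  A1 P *m x t + A2 P *m x (t - r)
  + mx_integral (- r) 0 (fun tau => A3 P *m tensI (f tau) n *m x (t + tau))
  + B1 P *m u t + B2 P *m u (t - r)
  + mx_integral (- r) 0 (fun tau => B3 P *m tensI (f tau) p *m u (t + tau))
  + D1 P *m w t.

Definition output (x : R -> 'cV[R]_n) (u : R -> 'cV[R]_p)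
    (w : R -> 'cV[R]_q) (t : R) : 'cV[R]_m :=
  C1 P *m x t + C2 P *m x (t - r)
  + mx_integral (- r) 0 (fun tau => C3 P *m tensI (f tau) n *m x (t + tau))
  + B4 P *m u t + B5 P *m u (t - r)
  + mx_integral (- r) 0 (fun tau => B6 P *m tensI (f tau) p *m u (t + tau))
  + D2 P *m w t.

Variables (K : 'M[R]_(p, n)) (t0 : R).

Definition feedback (x : R -> 'cV[R]_n) : R -> 'cV[R]_p := fun t => K *m x t.

Definition cls_rhs x w t := state_rhs x (feedback x) w t.
Definition cls_output x w t := output x (feedback x) w t.

Definition state_equation_at x w t : Prop :=
  has_derivative_on `[t0, +oo[ x t (cls_rhs x w t).

(* As w is only an L^2 signal, trajectories are Caratheodory solutions: x is
   the integral of its derivative, which is the right-hand side almost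
   everywhere. Solutions satisfying the state equation at every t >= t0 are
   among them. *)
Record cls_trajectory (phi : history r n) (w : R -> 'cV[R]_q)
    (x : R -> 'cV[R]_n) : Prop := {
  traj_continuous : {within `[t0 - r, +oo[, continuous x};
  traj_initial : forall theta : `[- r, 0]%classic,
    x (t0 + set_val theta) = phi theta;
  traj_ae : {ae lebesgue_measure, forall t, t0 <= t -> state_equation_at x w t};
  traj_integral : forall t, t0 <= t ->
    x t = x t0 + mx_integral t0 t (cls_rhs x w) }.

(* The derivative of t |-> v(x_t) exists and satisfies the dissipation
   inequality at every t >= t0 where the state equation holds: at all t >= t0
   for a classical solution, at almost all t >= t0 in general. *)
Definition dissipative (s : supply_rate R m q) : Prop :=
  exists v : history r n -> R,
    [/\ forall psi, differentiable v psi,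
        forall psi, 0 <= v psi &
        forall phi w x, square_integrable_on `[t0, +oo[ w ->
          cls_trajectory phi w x ->
          forall t, t0 <= t -> state_equation_at x w t ->
          exists dv : R,
            has_derivative_on `[t0, +oo[ (fun t' => v (segment_of r x t')) t dv
            /\ dv - supply s (cls_output x w t) (w t) <= 0].

Definition lyapunov_stable : Prop :=
  forall eps : R, 0 < eps -> exists2 delta : R, 0 < delta &
    forall phi x, cls_trajectory phi (fun=> 0) x -> `|phi| < delta ->
      forall t, t0 <= t -> `|x t| < eps.

Definition globally_attractive : Prop :=
  forall phi x, cls_trajectory phi (fun=> 0) x -> x t @[t --> +oo] --> (0 : 'cV[R]_n).

Definition globally_asymptotically_stable : Prop :=
  lyapunov_stable /\ globally_attractive.

End delay_system.

Section lmi.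
Context {R : realType} {n m p q d : nat}.
Variables (r : R) (f : R -> 'cV[R]_d) (M : 'M[R]_d).
Variables (P : plant R n m p q d) (U : uncertainty R n m p q d).
Variables (s : supply_rate R m q) (alpha : 'I_(2 + d) -> R).
Variables (Pa X : 'M[R]_n) (V : 'M[R]_(p, n)) (Qa : 'M[R]_(n, d * n)).
Variables (Ra : 'M[R]_(d * n)) (Sa Ua : 'M[R]_n).

(* nx is convertible to (2 + d) * n, and px to (2 + d) * p. *)
Local Notation nx := (n + (n + d * n))%N.
Local Notation px := (p + (p + d * p))%N.

Definition gram : 'M[R]_d := mx_integral (- r) 0 (fun tau => f tau *m (f tau)^T).

Definition sfF : 'M[R]_d := invmx gram.

Definition bigA : 'M[R]_(n, nx + q) :=
  row_mx (row_mx (A1 P) (row_mx (A2 P) (A3 P))) (D1 P).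
Definition bigB1 : 'M[R]_(n, px + q) :=
  row_mx (row_mx (B1 P) (row_mx (B2 P) (B3 P))) 0.

(* Col_i (alpha_i I_n) = alpha (x) I_n *)
Definition Col_alpha : 'M[R]_(nx, n) := tensI (\col_i alpha i) n.

Definition P_blocks : 'M[R]_(n, nx + q + m) :=
  row_mx (row_mx (row_mx Pa (row_mx 0 Qa)) 0) 0.

Definition Pi_blocks : 'M[R]_(n, nx + q + m) :=
  row_mx
    (bigA *m (((1%:M : 'M[R]_(2 + d)) *t X : 'M[R]_nx) ⊕ (1%:M : 'M[R]_q))
     + bigB1 *m (((1%:M : 'M[R]_(2 + d)) *t V : 'M[R]_(px, nx)) ⊕ (0 : 'M[R]_q)))
    0.

Definition Sigma_blocks : 'M[R]_(m, nx + q) :=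
  row_mx
    (row_mx (C1 P *m X + B4 P *m V)
      (row_mx (C2 P *m X + B5 P *m V)
         (C3 P *m ((1%:M : 'M[R]_d) *t X) + B6 P *m ((1%:M : 'M[R]_d) *t V))))
    (D2 P).

Definition F_blocks : 'M[R]_(d * n, nx + q) :=
  row_mx
    (row_mx (tensI (f 0) n)
       (row_mx (- tensI (f (- r)) n) (- (M *t (1%:M : 'M[R]_n)))))
    0.

Definition Phi : 'M[R]_(nx + q + m) :=
  Sy (col_mx (col_mx (col_mx Qa (col_mx 0 Ra)) (0 : 'M[R]_(q, d * n)))
        (0 : 'M[R]_(m, d * n))
      *m row_mx F_blocks (0 : 'M[R]_(d * n, m)))
  + (((Sa + r *: Ua) ⊕ ((- Sa) ⊕ (- (sfF *t Ua)))) ⊕ (- J3 s) ⊕ J1 s)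
  + Sy (col_mx (col_mx (0 : 'M[R]_(nx, m)) (- (J2 s)^T)) (Jt s)
        *m row_mx Sigma_blocks (0 : 'M[R]_m)).

Definition Theta : 'M[R]_(n + (nx + q + m)) :=
  Sy (col_mx (1%:M : 'M[R]_n)
        (col_mx (col_mx Col_alpha (0 : 'M[R]_(q, n))) (0 : 'M[R]_(m, n)))
      *m row_mx (- X) Pi_blocks)
  + sym2 0 P_blocks Phi.

(* Parenthesized as in the block-diagonal sums of [H_blocks]. *)
Definition size7 (a : 'I_14 -> nat) (i1 i2 i3 i4 i5 i6 i7 : 'I_14) : nat :=
  (((a i1 + a i2) + ((a i3 + a i4) + (a i5 + a i6))) + a i7)%N.
Definition size14 (a : 'I_14 -> nat) : nat :=
  (size7 a (ix 1) (ix 2) (ix 3) (ix 4) (ix 5) (ix 6) (ix 7)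
   + size7 a (ix 8) (ix 9) (ix 10) (ix 11) (ix 12) (ix 13) (ix 14))%N.

Definition dsum14 (a b : 'I_14 -> nat) (E : forall i, 'M[R]_(a i, b i)) :
    'M[R]_(size14 a, size14 b) :=
  (((E (ix 1) ⊕ E (ix 2)) ⊕ ((E (ix 3) ⊕ E (ix 4)) ⊕ (E (ix 5) ⊕ E (ix 6))))
     ⊕ E (ix 7))
  ⊕ (((E (ix 8) ⊕ E (ix 9))
       ⊕ ((E (ix 10) ⊕ E (ix 11)) ⊕ (E (ix 12) ⊕ E (ix 13)))) ⊕ E (ix 14)).

Definition F_Delta := dsum14 (uF U).
Definition bJ1 := dsum14 (uXi U).
Definition bJ2 := dsum14 (uLambda U).
Definition bJ3 := dsum14 (uGamma U).

Definition row7 (k : nat) (a1 a2 a3 a4 a5 a6 a7 : nat)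
    (E1 : 'M[R]_(k, a1)) (E2 : 'M[R]_(k, a2)) (E3 : 'M[R]_(k, a3))
    (E4 : 'M[R]_(k, a4)) (E5 : 'M[R]_(k, a5)) (E6 : 'M[R]_(k, a6))
    (E7 : 'M[R]_(k, a7)) :=
  row_mx (row_mx (row_mx E1 E2) (row_mx (row_mx E3 E4) (row_mx E5 E6))) E7.

Definition G_blocks : 'M[R]_(n + (nx + q + m), size14 (usize U)) :=
  col_mx (row_mx (1%:M : 'M[R]_n) (0 : 'M[R]_(n, m)))
    (col_mx
       (col_mx (row_mx Col_alpha (0 : 'M[R]_(nx, m)))
          (row_mx (0 : 'M[R]_(q, n)) (- (J2 s)^T)))
       (row_mx (0 : 'M[R]_(m, n)) (Jt s)))
  *m ((row7 (uG U (ix 1) : 'M[R]_(n, _)) (uG U (ix 2)) (uG U (ix 3)) (uG U (ix 4))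
         (uG U (ix 5)) (uG U (ix 6)) (uG U (ix 7)))
      ⊕ (row7 (uG U (ix 8) : 'M[R]_(m, _)) (uG U (ix 9)) (uG U (ix 10))
           (uG U (ix 11)) (uG U (ix 12)) (uG U (ix 13)) (uG U (ix 14)))).

Definition H_row {a1 a2 a3 a4 a5 a6 a7 : nat}
    (H1 : 'M[R]_(a1, n)) (H2 : 'M[R]_(a2, p)) (H3 : 'M[R]_(a3, n))
    (H4 : 'M[R]_(a4, p)) (H5 : 'M[R]_(a5, d * n)) (H6 : 'M[R]_(a6, d * p))
    (H7 : 'M[R]_(a7, q)) : 'M[R]_(_, nx + q) :=
  (col_mx (H1 *m X) (H2 *m V)
   ⊕ (col_mx (H3 *m X) (H4 *m V)
      ⊕ col_mx (H5 *m ((1%:M : 'M[R]_d) *t X)) (H6 *m ((1%:M : 'M[R]_d) *t V))))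
  ⊕ H7.

Definition H_blocks : 'M[R]_(size14 (ysize U), n + (nx + q + m)) :=
  col_mx
    (H_row (uH U (ix 1)) (uH U (ix 2)) (uH U (ix 3)) (uH U (ix 4))
       (uH U (ix 5)) (uH U (ix 6)) (uH U (ix 7)))
    (H_row (uH U (ix 8)) (uH U (ix 9)) (uH U (ix 10)) (uH U (ix 11))
       (uH U (ix 12)) (uH U (ix 13)) (uH U (ix 14)))
  *m row_mx (0 : 'M[R]_(nx + q, n))
       (row_mx (1%:M : 'M[R]_(nx + q)) (0 : 'M[R]_(nx + q, m))).

Definition lyapunov_lmi : Prop :=
  posdef (sym2 Pa Qa (Ra + sfF *t Sa)).

Definition well_posedness_lmi (k1 : R) : Prop :=
  posdef (sym3 (1%:M) (- 1%:M - k1 *: (F_Delta^T *m bJ2)) (k1 *: F_Delta^T)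
            (1%:M - k1 *: bJ3) 0
            (k1 *: bJ1)).

Definition main_lmi (k2 : R) : Prop :=
  negdef (sym3 Theta (G_blocks + k2 *: (H_blocks^T *m bJ2)) (k2 *: H_blocks^T)
            (k2 *: (F_Delta^T *m bJ2) + k2 *: (bJ2^T *m F_Delta) + k2 *: bJ3)
            (k2 *: F_Delta^T)
            (- (k2 *: bJ1))).

End lmi.

(* Main.v *)
From HB Require Import structures.
Require Import Defs.
From mathcomp Require Import all_boot all_order all_algebra mxtens ring lra.
From mathcomp Require Import all_classical all_reals all_analysis.
Set Implicit Arguments. Unset Strict Implicit. Unset Printing Implicit Defensive.
Import Order.TTheory GRing.Theory Num.Theory.
Import numFieldNormedType.Exports.
Local Open Scope classical_set_scope.
Local Open Scope ring_scope.

(** Three independent ideas are combined.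

    The uncertainty is eliminated pointwise, by the S-procedure. An admissible
    [Delta] relates the vectors [u] and [v = Delta u] by a quadratic inequality,
    and the form of the large matrix inequality, evaluated at a vector built
    from [z], [u] and [v], is the form of the perturbed [Theta] at [z] plus a
    multiple of the nonnegative quantity of that inequality
    ([perturbed_negdef], [admissible_Theta_negdef]). The same
    device applied to the inequality in [k1] shows that [I - Delta F] has no
    kernel ([well_posed_unitmx]). What follows therefore concerns one plant for
    which [Theta] is negative definite.

    In the variable [y = X^-1 x] the unknowns of the inequalities define a
    Lyapunov-Krasovskii functional: a quadratic form of [y t] and of the window
    integral of [f (x) y], plus integrals over the window of the forms of [Sa]
    and of [(tau + r) Ua] ([functional]). Bessel's inequality for the span of
    the entries of [f] ([integral_quad_form_ge]) bounds it below by the form of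
    the matrix of [lyapunov_lmi], hence by [c |y t|^2]. Along a trajectory, the
    derivative of [y] is only needed at the current time: the weights of the
    window integrals are differentiable, and integration by parts moves the
    derivative onto them ([is_derive_window_integral]); the equation
    [f' = M f] then expresses the result through the same integrals. The
    integral of the form of [Ua] being bounded by Bessel's inequality again, the
    derivative minus the supply rate is at most the form of [Theta] at a vector
    read off the trajectory ([quad_form_Theta], [functional_dissipation]). This
    is dissipativity; the functional is differentiable on the space of histories
    because it is a bounded quadratic form ([bounded_quadratic_differentiable]).

    For [w = 0] the supply rate is nonpositive, and negative definiteness of
    [Theta] leaves a margin: the derivative is at most [- eps |y t|^2]. The
    trajectories are then classical, the right-hand side being continuous, so
    that the mean value theorem integrates this bound
    ([unforced_functional_decrease]). Stability follows as the functional lies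
    between [c |y t|^2] and a multiple of the squared norm of the history
    ([scaled_bound], [closed_loop_stable]); attractivity is Barbalat's argument,
    the state being Lipschitz and the functional bounded below
    ([closed_loop_attractive]). *)

(** * Quadratic forms *)

Section dot.
Context {R : realType}.

Definition dot {k} (x y : 'cV[R]_k) : R := (x^T *m y) 0 0.

Lemma dotE k (x y : 'cV[R]_k) : dot x y = \sum_i x i 0 * y i 0.
Proof. by rewrite /dot mxE; apply: eq_bigr => i _; rewrite mxE. Qed.

Lemma dotC k (x y : 'cV[R]_k) : dot x y = dot y x.
Proof. by rewrite !dotE; apply: eq_bigr => i _; rewrite mulrC. Qed.

Lemma dotDl k (x y z : 'cV[R]_k) : dot (x + y) z = dot x z + dot y z.
Proof. by rewrite /dot linearD mulmxDl mxE. Qed.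

Lemma dotDr k (x y z : 'cV[R]_k) : dot z (x + y) = dot z x + dot z y.
Proof. by rewrite /dot mulmxDr mxE. Qed.

Lemma dotNl k (x y : 'cV[R]_k) : dot (- x) y = - dot x y.
Proof. by rewrite /dot linearN mulNmx mxE. Qed.

Lemma dotNr k (x y : 'cV[R]_k) : dot x (- y) = - dot x y.
Proof. by rewrite /dot mulmxN mxE. Qed.

Lemma dotZl k a (x y : 'cV[R]_k) : dot (a *: x) y = a * dot x y.
Proof. by rewrite /dot linearZ -scalemxAl mxE. Qed.

Lemma dotZr k a (x y : 'cV[R]_k) : dot x (a *: y) = a * dot x y.
Proof. by rewrite /dot -scalemxAr mxE. Qed.

Lemma dot0l k (x : 'cV[R]_k) : dot 0 x = 0.
Proof. by rewrite /dot trmx0 mul0mx mxE. Qed.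

Lemma dot0r k (x : 'cV[R]_k) : dot x 0 = 0.
Proof. by rewrite dotC dot0l. Qed.

Lemma dot_mull k l (A : 'M[R]_(k, l)) (x : 'cV[R]_l) (y : 'cV[R]_k) :
  dot (A *m x) y = dot x (A^T *m y).
Proof. by rewrite /dot trmx_mul mulmxA. Qed.

Lemma dot_trmx k l (A : 'M[R]_(k, l)) (x : 'cV[R]_l) (y : 'cV[R]_k) :
  dot x (A^T *m y) = dot y (A *m x).
Proof. by rewrite -dot_mull dotC. Qed.

Lemma dot_col k l (x1 y1 : 'cV[R]_k) (x2 y2 : 'cV[R]_l) :
  dot (col_mx x1 x2) (col_mx y1 y2) = dot x1 y1 + dot x2 y2.
Proof. by rewrite /dot tr_col_mx mul_row_col mxE. Qed.

Definition dotrules := (dotDl, dotDr, dotNl, dotNr, dotZl, dotZr, dot0l, dot0r).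

Lemma dot_ge0 k (x : 'cV[R]_k) : 0 <= dot x x.
Proof. by rewrite dotE sumr_ge0// => i _; rewrite -expr2 sqr_ge0. Qed.

Lemma coord_le_dot k (x : 'cV[R]_k) i : x i 0 ^+ 2 <= dot x x.
Proof.
rewrite dotE (bigD1 i)//= -expr2 lerDl sumr_ge0// => j _.
by rewrite -expr2 sqr_ge0.
Qed.

Lemma quad_formE k (A : 'M[R]_k) (x : 'cV[R]_k) : quad_form A x = dot x (A *m x).
Proof. by rewrite /quad_form /dot mulmxA. Qed.

Lemma quad_formS k (A : 'M[R]_k) (x y : 'cV[R]_k) : A^T = A ->
  dot x (A *m y) = dot y (A *m x).
Proof. by move=> sA; rewrite -{1}sA dot_trmx. Qed.

Lemma quad_form_sym2 k l (A : 'M[R]_k) (B : 'M[R]_(k, l)) (D : 'M[R]_l) x y :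
  quad_form (sym2 A B D) (col_mx x y) =
  quad_form A x + 2 * dot x (B *m y) + quad_form D y.
Proof.
rewrite !quad_formE /sym2 mul_block_col dot_col !dotDr dot_trmx; ring.
Qed.

Lemma quad_form_Sy k (A : 'M[R]_k) x : quad_form (Sy A) x = 2 * dot x (A *m x).
Proof. by rewrite quad_formE /Sy mulmxDl dotDr dot_trmx; ring. Qed.

Lemma quad_formD k (A B : 'M[R]_k) x :
  quad_form (A + B) x = quad_form A x + quad_form B x.
Proof. by rewrite !quad_formE mulmxDl dotDr. Qed.

Lemma quad_formN k (A : 'M[R]_k) x : quad_form (- A) x = - quad_form A x.
Proof. by rewrite !quad_formE mulNmx dotNr. Qed.

Lemma quad_formZ k a (A : 'M[R]_k) x : quad_form (a *: A) x = a * quad_form A x.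
Proof. by rewrite !quad_formE -scalemxAl dotZr. Qed.

Lemma quad_form_dsum k l (A : 'M[R]_k) (B : 'M[R]_l) x y :
  quad_form (dsum A B) (col_mx x y) = quad_form A x + quad_form B y.
Proof.
by rewrite !quad_formE /dsum mul_block_col !mul0mx addr0 add0r dot_col.
Qed.

Lemma unitmx_ker k (A : 'M[R]_k) :
  (forall x : 'cV[R]_k, A *m x = 0 -> x = 0) -> A \in unitmx.
Proof.
move=> kerA; rewrite -unitmx_tr -row_free_unit; apply: inj_row_free => v vA.
apply: trmx_inj; rewrite trmx0; apply: kerA.
by rewrite -[A]trmxK -trmx_mul vA trmx0.
Qed.

Lemma possemidef_posdef k (A : 'M[R]_k) : posdef A -> possemidef A.
Proof.
case=> sA pA; split=> // x; have [->|/pA/ltW//] := eqVneq x 0.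
by rewrite quad_formE dot0l.
Qed.

Lemma posdef_unitmx k (A : 'M[R]_k) : posdef A -> A \in unitmx.
Proof.
case=> _ pA; apply: unitmx_ker => x Ax; apply/eqP; apply: contraT => /pA.
by rewrite quad_formE Ax dot0r ltxx.
Qed.

Lemma dot_bounded k (A : 'M[R]_k) : exists2 C : R, 0 < C &
  forall x, quad_form A x <= C * dot x x.
Proof.
exists (1 + \sum_i \sum_j `|A i j|) => [|x].
  by rewrite ltr_pwDl// sumr_ge0// => i _; rewrite sumr_ge0.
rewrite quad_formE mulrDl mul1r; set s := \sum_i _.
suff : dot x (A *m x) <= s * dot x x by have := dot_ge0 x; lra.
rewrite {1}dotE mulr_suml ler_sum// => i _.
rewrite mxE mulr_sumr mulr_suml ler_sum// => j _.
have := coord_le_dot x i; have := coord_le_dot x j.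
set a := x i 0; set b := x j 0; set D := dot x x => bD aD.
have : `|a * b| <= D.
  by rewrite ler_norml; apply/andP; split; nra.
move=> abD; rewrite mulrCA; apply: le_trans (ler_norm _) _.
by rewrite normrM ler_wpM2l.
Qed.

(** Cauchy-Schwarz for the form of [A], applied to [x] and [A^-1 x], bounds the
    square of [dot x x] by the product of the values at [x] of the forms of [A]
    and [A^-1]. The latter is at most [C * dot x x], so that [C^-1] is a
    coercivity constant, and compactness of the unit sphere is avoided. *)
Lemma posdef_coercive k (A : 'M[R]_k) : posdef A -> exists2 c : R, 0 < c &
  forall x, c * dot x x <= quad_form A x.
Proof.
move=> dA; have uA := posdef_unitmx dA; have [sA pA] := dA.
have [_ ppA] := possemidef_posdef dA.
have [C C0 hC] := dot_bounded (invmx A).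
exists C^-1 => [|x]; first by rewrite invr_gt0.
set y := invmx A *m x.
(* nonnegativity of the form of A at C x - A^-1 x is all that is needed of
   the Cauchy-Schwarz inequality *)
have Ay : A *m y = x by rewrite /y mulKVmx.
have := ppA (C *: x - y); have := hC x.
rewrite !quad_formE mulmxBr -scalemxAr -/y Ay !dotrules.
rewrite (quad_formS y x sA) Ay [dot y x]dotC => h1 h2.
rewrite ler_pdivrMl//.
rewrite -(ler_pM2l C0).
nra.
Qed.

End dot.

(** * Elimination of the uncertainty *)

Section uncertainty.
Context {R : realType}.

Section one_block.
Variables (k l u : nat).
Variables (F : 'M[R]_(l, u)) (D : 'M[R]_(u, l)).
Variables (Xi N : 'M[R]_l) (L : 'M[R]_(l, u)) (Gm : 'M[R]_u).
Hypothesis XiN : Xi *m N = 1%:M.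

(** The quadratic constraint on the uncertainty [D], expanded; [N] stands for
    the inverse of [Xi]. *)
Definition uncertainty_form : 'M[R]_l :=
  N + Sy (L *m D) + D^T *m Gm *m D.

Hypothesis D_adm : forall y, 0 <= quad_form uncertainty_form y.

Lemma uncertainty_formE y v : D *m y = v ->
  quad_form uncertainty_form y =
  dot y (N *m y) + 2 * dot y (L *m v) + dot v (Gm *m v).
Proof.
move=> Dy; rewrite /uncertainty_form 2!quad_formD quad_form_Sy !quad_formE.
by rewrite -!mulmxA Dy -dot_mull Dy.
Qed.

(** A kernel vector [v] of [1 - D F] satisfies [v = D y] with [y = F v], and the
    form of the hypothesis takes at [(v, v, - Xi^-1 y)] the value of the
    constraint on [D] at [y], multiplied by [- a]. It cannot be positive, hence
    [v = 0]. *)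
Lemma well_posed_unitmx (a : R) : 0 < a ->
  posdef (sym3 (1%:M) (- 1%:M - a *: (F^T *m L)) (a *: F^T)
            (1%:M - a *: Gm) 0 (a *: Xi)) ->
  1%:M - D *m F \in unitmx.
Proof.
move=> a0 [_ wp]; apply: unitmx_ker => v.
rewrite mulmxBl mul1mx -mulmxA => /eqP; rewrite subr_eq0 => /eqP vE.
set y := F *m v in vE; pose c := - (N *m y).
apply/eqP; apply: contraT => v0.
have /wp : col_mx v (col_mx v c) != 0.
  by apply: contra_neq v0 => /eqP; rewrite col_mx_eq0 => /andP[/eqP].
rewrite /sym3 !quad_form_sym2 !quad_formE.
have XNy : Xi *m c = - y by rewrite /c mulmxN mulmxA XiN mul1mx.
rewrite mul_row_col !mulmxDl !mulNmx !mul1mx !mul0mx -!scalemxAl XNy !dotrules.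
rewrite -!mulmxA !dot_trmx /c !dotrules -/y.
rewrite [dot (N *m y) _]dotC [dot (L *m v) _]dotC.
have := D_adm y; rewrite (uncertainty_formE (esym vE)); nra.
Qed.

(** The S-procedure, vector by vector. Put [v = (1 - D F)^-1 D H z], so that
    [v = D y] with [y = H z + F v]. At [(z, v, Xi^-1 y)] the large form is the
    sum of the perturbed form at [z] and of [a] times the constraint on [D] at
    [y]; the constraint being nonnegative, the perturbed form is negative. *)
Lemma perturbed_negdef (Th : 'M[R]_k) (G : 'M[R]_(k, u)) (H : 'M[R]_(l, k))
    (a : R) : 0 < a -> 1%:M - D *m F \in unitmx ->
  negdef (sym3 Th (G + a *: (H^T *m L)) (a *: H^T)
            (a *: (F^T *m L) + a *: (L^T *m F) + a *: Gm)
            (a *: F^T) (- (a *: Xi))) ->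
  forall z, z != 0 ->
    quad_form (Th + Sy (G *m (invmx (1%:M - D *m F) *m D) *m H)) z < 0.
Proof.
move=> a0 u1 [_ main] z z0.
pose v := invmx (1%:M - D *m F) *m D *m (H *m z).
pose y := H *m z + F *m v.
have vE : D *m y = v.
  have : (1%:M - D *m F) *m v = D *m (H *m z) by rewrite /v -!mulmxA mulKVmx.
  by rewrite mulmxBl mul1mx /y mulmxDr => <-; rewrite mulmxA addrNK.
pose c := N *m y.
have XNy : Xi *m c = y by rewrite /c mulmxA XiN mul1mx.
have /main : col_mx z (col_mx v c) != 0.
  by apply: contra_neq z0 => /eqP; rewrite col_mx_eq0 => /andP[/eqP].
rewrite [quad_form (Th + _) _]quad_formD quad_form_Sy quad_formN /sym3.
rewrite !quad_form_sym2 !quad_formE.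
rewrite !mul_row_col !mulmxDl !mulNmx -!scalemxAl XNy !dotrules.
have -> : G *m (invmx (1%:M - D *m F) *m D) *m H *m z = G *m v.
  by rewrite /v -!mulmxA.
rewrite -!mulmxA !dot_trmx.
have -> : H *m z = y - F *m v by rewrite /y addrK.
clearbody y.
have := D_adm y; rewrite (uncertainty_formE vE) -/c !dotrules.
rewrite [dot y c]dotC [dot y (L *m v)]dotC [dot (F *m v) (L *m v)]dotC.
nra.
Qed.

End one_block.

End uncertainty.

(** * Block-diagonal sums of fourteen blocks *)

Local Notation ix k := (@Ordinal 14 k.-1 isT).

Section dsum.
Context {R : realType}.

Lemma dsum_mul k1 l1 o1 k2 l2 o2 (A : 'M[R]_(k1, l1)) (B : 'M[R]_(k2, l2))
    (C : 'M[R]_(l1, o1)) (D : 'M[R]_(l2, o2)) :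
  dsum A B *m dsum C D = dsum (A *m C) (B *m D).
Proof. by rewrite /dsum mulmx_block !mul0mx !mulmx0 !addr0 !add0r. Qed.

Lemma dsumD k1 l1 k2 l2 (A C : 'M[R]_(k1, l1)) (B D : 'M[R]_(k2, l2)) :
  dsum A B + dsum C D = dsum (A + C) (B + D).
Proof. by rewrite /dsum add_block_mx !addr0. Qed.

Lemma dsumN k1 l1 k2 l2 (A : 'M[R]_(k1, l1)) (B : 'M[R]_(k2, l2)) :
  - dsum A B = dsum (- A) (- B).
Proof. by rewrite /dsum opp_block_mx !oppr0. Qed.

Lemma dsum_tr k1 l1 k2 l2 (A : 'M[R]_(k1, l1)) (B : 'M[R]_(k2, l2)) :
  (dsum A B)^T = dsum A^T B^T.
Proof. by rewrite /dsum tr_block_mx !trmx0. Qed.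

Lemma dsum1 k l : dsum (1%:M : 'M[R]_k) (1%:M : 'M[R]_l) = 1%:M.
Proof. by rewrite /dsum -scalar_mx_block. Qed.

Lemma dsum_unitmx k l (A : 'M[R]_k) (B : 'M[R]_l) :
  (dsum A B \in unitmx) = (A \in unitmx) && (B \in unitmx).
Proof. by rewrite !unitmxE /dsum det_ublock unitrM. Qed.

Lemma dsum_inv k l (A : 'M[R]_k) (B : 'M[R]_l) :
  A \in unitmx -> B \in unitmx -> invmx (dsum A B) = dsum (invmx A) (invmx B).
Proof.
move=> uA uB; have uAB : dsum A B \in unitmx by rewrite dsum_unitmx uA.
apply: (can_inj (mulKmx uAB)).
by rewrite mulmxV// dsum_mul !mulmxV// dsum1.
Qed.

Lemma dsum_possemidef k l (A : 'M[R]_k) (B : 'M[R]_l) :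
  possemidef A -> possemidef B -> possemidef (dsum A B).
Proof.
move=> [sA pA] [sB pB]; split=> [|x]; first by rewrite dsum_tr sA sB.
by rewrite -[x]vsubmxK quad_form_dsum addr_ge0.
Qed.

Implicit Types a b c : 'I_14 -> nat.

Lemma dsum14_mul a b c (A : forall i, 'M[R]_(a i, b i))
    (B : forall i, 'M[R]_(b i, c i)) :
  dsum14 A *m dsum14 B = dsum14 (fun i => A i *m B i).
Proof. by rewrite /dsum14 !dsum_mul. Qed.

Lemma dsum14D a b (A B : forall i, 'M[R]_(a i, b i)) :
  dsum14 A + dsum14 B = dsum14 (fun i => A i + B i).
Proof. by rewrite /dsum14 !dsumD. Qed.

Lemma dsum14N a b (A : forall i, 'M[R]_(a i, b i)) :
  - dsum14 A = dsum14 (fun i => - A i).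
Proof. by rewrite /dsum14 !dsumN. Qed.

Lemma dsum14_tr a b (A : forall i, 'M[R]_(a i, b i)) :
  (dsum14 A)^T = dsum14 (fun i => (A i)^T).
Proof. by rewrite /dsum14 !dsum_tr. Qed.

Lemma dsum14_1 a : dsum14 (fun i => 1%:M : 'M[R]_(a i)) = 1%:M.
Proof. by rewrite /dsum14 !dsum1. Qed.

Lemma eq_dsum14 a b (A B : forall i, 'M[R]_(a i, b i)) :
  (forall i, A i = B i) -> dsum14 A = dsum14 B.
Proof. by move=> AB; rewrite /dsum14 !AB. Qed.

Lemma dsum14_possemidef a (A : forall i, 'M[R]_(a i)) :
  (forall i, possemidef (A i)) -> possemidef (dsum14 A).
Proof. by move=> pA; do !apply: dsum_possemidef. Qed.

(** The blocks of [dsum14] are reached one by one: they have different sizes,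
    so that no statement about them is uniform in the index. *)
Lemma ord14_ind (T : 'I_14 -> Prop) :
  T (ix 1) -> T (ix 2) -> T (ix 3) -> T (ix 4) -> T (ix 5) -> T (ix 6) ->
  T (ix 7) -> T (ix 8) -> T (ix 9) -> T (ix 10) -> T (ix 11) -> T (ix 12) ->
  T (ix 13) -> T (ix 14) -> forall i, T i.
Proof.
move=> T1 T2 T3 T4 T5 T6 T7 T8 T9 T10 T11 T12 T13 T14 [i lt_i].
do 14?[case: i lt_i => [|i] lt_i; first by rewrite (bool_irrelevance lt_i isT)].
by [].
Qed.

Lemma dsum14_unitmx a (A : forall i, 'M[R]_(a i)) :
  dsum14 A \in unitmx <-> forall i, A i \in unitmx.
Proof.
rewrite /dsum14 !dsum_unitmx; split=> [uA|uA]; last by rewrite !uA.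
by apply: ord14_ind; case/andP: uA => /andP[/andP[/andP[? ?] /andP[
  /andP[? ?] /andP[? ?]]] ?] /andP[/andP[/andP[? ?] /andP[
  /andP[? ?] /andP[? ?]]] ?].
Qed.

Lemma dsum14_inv a (A : forall i, 'M[R]_(a i)) :
  (forall i, A i \in unitmx) -> invmx (dsum14 A) = dsum14 (fun i => invmx (A i)).
Proof. by move=> uA; rewrite /dsum14 !dsum_inv// ?dsum_unitmx ?uA. Qed.

End dsum.

(** * Kronecker products *)

Section kronecker.
Context {R : realType}.

Lemma sum_mxtens_index k l (F : 'I_(k * l) -> R) :
  \sum_a F a = \sum_i \sum_j F (mxtens_index (i, j)).
Proof.
rewrite pair_big (reindex (@mxtens_index k l))/=.
  by apply: eq_bigr => -[i j].
by exists (@mxtens_unindex k l) => a _; rewrite (mxtens_indexK, mxtens_unindexK).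
Qed.

Lemma tensIE l (v : 'cV[R]_l) k i (j j' : 'I_k) :
  tensI v k (mxtens_index (i, j)) j' = v i 0 * (j == j')%:R.
Proof.
rewrite /tensI castmxE/= mxE cast_ord_id mxtens_indexK mxE ord1.
congr (_ * _%:R); congr (nat_of_bool (_ == _)); apply: val_inj => /=.
by rewrite modn_small// ltn_ord.
Qed.

Lemma mul_tensI l (v : 'cV[R]_l) k o (B : 'M[R]_(k, o)) i j j' :
  (tensI v k *m B) (mxtens_index (i, j)) j' = v i 0 * B j j'.
Proof.
rewrite mxE (bigD1 j)//= tensIE eqxx mulr1 big1 ?addr0// => j'' /negPf jj.
by rewrite tensIE eq_sym jj mulr0 mul0r.
Qed.

(** Moves a Kronecker product through [v (x) I_k]: it is what exchanges
    [f (x) I] and the gain, and turns multiplication by [M (x) I] into the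
    replacement of [f] by its derivative [M f]. *)
Lemma tens_mul_tensI l l' k k' (A : 'M[R]_(l', l)) (B : 'M[R]_(k', k)) v :
  (A *t B) *m tensI v k = tensI (A *m v) k' *m B.
Proof.
apply/matrixP => a j'; case: (mxtens_indexP a) => i j.
rewrite mul_tensI mxE sum_mxtens_index [in RHS]mxE mulr_suml.
apply: eq_bigr => i' _; rewrite (bigD1 j')//= tensIE tensmxE eqxx mulr1.
rewrite big1 ?addr0 => [|j'' /negPf jj]; first by rewrite mulrAC.
by rewrite tensIE jj !mulr0.
Qed.

Lemma tensI_mul_tr l l' k (u : 'cV[R]_l) (v : 'cV[R]_l') (S : 'M[R]_k) :
  tensI u k *m S *m (tensI v k)^T = (u *m v^T) *t S.
Proof.
apply/matrixP => a b; case: (mxtens_indexP a) => i j.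
case: (mxtens_indexP b) => i' j'.
rewrite tensmxE -{1}[S]trmxK -mulmxA -trmx_mul mul_tensI.
by rewrite [X in _ * X]mxE mul_tensI !mxE big_ord1 mxE mulrA.
Qed.

(** The type ascription holds by conversion, [d.+1 * k] being [k + d * k]; the
    blocks of [I_(2 + d) (x) X] are obtained by using the lemma twice. *)
Lemma tens1_dsum d k l (X : 'M[R]_(k, l)) :
  ((1%:M : 'M[R]_d.+1) *t X : 'M[R]_(k + d * k, l + d * l))
  = dsum X ((1%:M : 'M[R]_d) *t X).
Proof.
have tE (i i' : 'I_d.+1) j j' :
    ((1%:M : 'M[R]_d.+1) *t X : 'M[R]_(k + d * k, l + d * l))
      (mxtens_index (i, j)) (mxtens_index (i', j')) = (i == i')%:R * X j j'.
  by apply: etrans (tensmxE _ _ _ _ _ _) _; rewrite mxE.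
apply/matrixP => a b; rewrite /dsum.
case: (splitP a) => [a0|a1] ea; case: (splitP b) => [b0|b1] eb.
- have -> : a = lshift _ a0 by apply: val_inj.
  have -> : b = lshift _ b0 by apply: val_inj.
  rewrite block_mxEul.
  have -> : lshift (d * k) a0 = mxtens_index (@ord0 d, a0) by apply: val_inj.
  have -> : lshift (d * l) b0 = mxtens_index (@ord0 d, b0) by apply: val_inj.
  by rewrite tE mul1r.
- have -> : a = lshift _ a0 by apply: val_inj.
  have -> : b = rshift _ b1 by apply: val_inj.
  rewrite block_mxEur [RHS]mxE.
  have -> : lshift (d * k) a0 = mxtens_index (@ord0 d, a0) by apply: val_inj.
  case: (mxtens_indexP b1) => i j.
  have -> : rshift l (mxtens_index (i, j)) = mxtens_index (lift (@ord0 d) i, j).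
    by apply: val_inj => /=; rewrite addnA mulSn.
  by rewrite tE mul0r.
- have -> : a = rshift _ a1 by apply: val_inj.
  have -> : b = lshift _ b0 by apply: val_inj.
  rewrite block_mxEdl [RHS]mxE.
  have -> : lshift (d * l) b0 = mxtens_index (@ord0 d, b0) by apply: val_inj.
  case: (mxtens_indexP a1) => i j.
  have -> : rshift k (mxtens_index (i, j)) = mxtens_index (lift (@ord0 d) i, j).
    by apply: val_inj => /=; rewrite addnA mulSn.
  by rewrite tE mul0r.
have -> : a = rshift _ a1 by apply: val_inj.
have -> : b = rshift _ b1 by apply: val_inj.
rewrite block_mxEdr; case: (mxtens_indexP a1) => i j.
case: (mxtens_indexP b1) => i' j'.
have -> : rshift k (mxtens_index (i, j)) = mxtens_index (lift (@ord0 d) i, j).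
  by apply: val_inj => /=; rewrite addnA mulSn.
have -> : rshift l (mxtens_index (i', j')) = mxtens_index (lift (@ord0 d) i', j').
  by apply: val_inj => /=; rewrite addnA mulSn.
by rewrite tE tensmxE mxE (inj_eq (@lift_inj _ ord0)).
Qed.

End kronecker.

(** * The perturbed linear matrix inequality *)

Section perturbed_lmi.
Context {R : realType} {n m p q d : nat}.

Section rows.
Variables (a1 a2 a3 a4 a5 a6 a7 : nat).

Lemma row7_dsum k b1 b2 b3 b4 b5 b6 b7
    (E1 : 'M[R]_(k, a1)) (E2 : 'M[R]_(k, a2)) (E3 : 'M[R]_(k, a3))
    (E4 : 'M[R]_(k, a4)) (E5 : 'M[R]_(k, a5)) (E6 : 'M[R]_(k, a6))
    (E7 : 'M[R]_(k, a7))
    (D1 : 'M[R]_(a1, b1)) (D2 : 'M[R]_(a2, b2)) (D3 : 'M[R]_(a3, b3))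
    (D4 : 'M[R]_(a4, b4)) (D5 : 'M[R]_(a5, b5)) (D6 : 'M[R]_(a6, b6))
    (D7 : 'M[R]_(a7, b7)) :
  row7 E1 E2 E3 E4 E5 E6 E7
    *m dsum (dsum (dsum D1 D2) (dsum (dsum D3 D4) (dsum D5 D6))) D7
  = row7 (E1 *m D1) (E2 *m D2) (E3 *m D3) (E4 *m D4) (E5 *m D5) (E6 *m D6)
      (E7 *m D7).
Proof. by rewrite /row7 /dsum !mul_row_block !mulmx0 !addr0 !add0r. Qed.

Lemma row7_H_row k (X : 'M[R]_n) (V : 'M[R]_(p, n))
    (E1 : 'M[R]_(k, a1)) (E2 : 'M[R]_(k, a2)) (E3 : 'M[R]_(k, a3))
    (E4 : 'M[R]_(k, a4)) (E5 : 'M[R]_(k, a5)) (E6 : 'M[R]_(k, a6))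
    (E7 : 'M[R]_(k, a7))
    (H1 : 'M[R]_(a1, n)) (H2 : 'M[R]_(a2, p)) (H3 : 'M[R]_(a3, n))
    (H4 : 'M[R]_(a4, p)) (H5 : 'M[R]_(a5, d * n)) (H6 : 'M[R]_(a6, d * p))
    (H7 : 'M[R]_(a7, q)) :
  row7 E1 E2 E3 E4 E5 E6 E7 *m H_row X V H1 H2 H3 H4 H5 H6 H7
  = row_mx (row_mx (E1 *m H1 *m X + E2 *m H2 *m V)
      (row_mx (E3 *m H3 *m X + E4 *m H4 *m V)
        (E5 *m H5 *m ((1%:M : 'M[R]_d) *t X)
         + E6 *m H6 *m ((1%:M : 'M[R]_d) *t V)))) (E7 *m H7).
Proof.
rewrite /row7 /H_row /dsum !mul_row_block !mul_row_col !mulmx0 !addr0 !add0r.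
by rewrite !mulmxA.
Qed.

End rows.

Variables (P : plant R n m p q d) (U : uncertainty R n m p q d).
Variables (X : 'M[R]_n) (V : 'M[R]_(p, n)).

Lemma Pi_blocksE (Q : plant R n m p q d) :
  Pi_blocks Q X V =
  row_mx (row_mx (row_mx (A1 Q *m X + B1 Q *m V)
      (row_mx (A2 Q *m X + B2 Q *m V)
        (A3 Q *m ((1%:M : 'M[R]_d) *t X) + B3 Q *m ((1%:M : 'M[R]_d) *t V))))
     (D1 Q)) 0.
Proof.
rewrite /Pi_blocks /bigA /bigB1 !tens1_dsum /dsum.
rewrite !mul_row_block. rewrite !mulmx0 ?mul0mx !addr0 !add0r mulmx1.
by rewrite !add_row_mx addr0.
Qed.

Variables (r : R) (f : R -> 'cV[R]_d) (M : 'M[R]_d).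
Variables (s : supply_rate R m q) (alpha : 'I_(2 + d) -> R).
Variables (Pa : 'M[R]_n) (Qa : 'M[R]_(n, d * n)).
Variables (Ra : 'M[R]_(d * n)) (Sa Ua : 'M[R]_n).
Variable Delta : perturbation U.

Let D i := invmx (1%:M - Delta i *m uF U i) *m Delta i.
Let nx := (n + (n + d * n))%N.

Let W1 := row7 ((uG U (ix 1) : 'M[R]_(n, _)) *m D (ix 1)) (uG U (ix 2) *m D (ix 2))
  (uG U (ix 3) *m D (ix 3)) (uG U (ix 4) *m D (ix 4)) (uG U (ix 5) *m D (ix 5))
  (uG U (ix 6) *m D (ix 6)) (uG U (ix 7) *m D (ix 7)).
Let H1 := H_row X V (uH U (ix 1)) (uH U (ix 2)) (uH U (ix 3)) (uH U (ix 4))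
       (uH U (ix 5)) (uH U (ix 6)) (uH U (ix 7)).
Let W2 := row7 ((uG U (ix 8) : 'M[R]_(m, _)) *m D (ix 8)) (uG U (ix 9) *m D (ix 9))
  (uG U (ix 10) *m D (ix 10)) (uG U (ix 11) *m D (ix 11))
  (uG U (ix 12) *m D (ix 12))
  (uG U (ix 13) *m D (ix 13)) (uG U (ix 14) *m D (ix 14)).
Let H2 := H_row X V (uH U (ix 8)) (uH U (ix 9)) (uH U (ix 10)) (uH U (ix 11))
       (uH U (ix 12)) (uH U (ix 13)) (uH U (ix 14)).

Lemma Pi_blocks_perturb :
  Pi_blocks (perturb P Delta) X V = Pi_blocks P X V + row_mx (W1 *m H1) 0.
Proof.
rewrite !Pi_blocksE /W1 /H1 row7_H_row.
rewrite !add_row_mx addr0 /perturb /= /block_error /D.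
congr (row_mx (row_mx (row_mx _ (row_mx _ _)) _) _); last by rewrite !mulmxA.
all: by rewrite !mulmxDl !mulmxA addrACA.
Qed.

Lemma Sigma_blocks_perturb :
  Sigma_blocks (perturb P Delta) X V = Sigma_blocks P X V + W2 *m H2.
Proof.
rewrite /Sigma_blocks /W2 /H2 row7_H_row.
rewrite !add_row_mx /perturb /= /block_error /D.
congr (row_mx (row_mx _ (row_mx _ _)) _); last by rewrite !mulmxA.
all: by rewrite !mulmxDl !mulmxA addrACA.
Qed.

Lemma SyD k (A B : 'M[R]_k) : Sy (A + B) = Sy A + Sy B.
Proof. by rewrite /Sy linearD/= addrACA. Qed.

Lemma sym2D k l (A A' : 'M[R]_k) (B B' : 'M[R]_(k, l)) (C C' : 'M[R]_l) :
  sym2 (A + A') (B + B') (C + C') = sym2 A B C + sym2 A' B' C'.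
Proof. by rewrite /sym2 add_block_mx linearD. Qed.

Lemma sym2_Sy k l (C : 'M[R]_l) : sym2 (0 : 'M[R]_k) 0 (Sy C) = Sy (dsum 0 C).
Proof.
by rewrite /sym2 /Sy dsum_tr !trmx0 dsumD addr0.
Qed.

(** [Theta] is affine in the matrices of the plant, and [G_blocks], [H_blocks]
    are the factors of its dependence on the perturbed ones. *)
Lemma Theta_perturb :
  Theta r f M (perturb P Delta) s alpha Pa X V Qa Ra Sa Ua =
  Theta r f M P s alpha Pa X V Qa Ra Sa Ua
  + Sy (G_blocks U s alpha *m dsum14 D *m H_blocks U X V).
Proof.
pose L1 : 'M[R]_(n + (nx + q + m), n) := col_mx (1%:M : 'M[R]_n)
  (col_mx (col_mx (Col_alpha alpha) (0 : 'M[R]_(q, n))) (0 : 'M[R]_(m, n))).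
pose L2 : 'M[R]_(nx + q + m, m) :=
  col_mx (col_mx (0 : 'M[R]_(nx, m)) (- (J2 s)^T)) (Jt s).
have PhiE : Phi r f M (perturb P Delta) s X V Qa Ra Sa Ua
  = Phi r f M P s X V Qa Ra Sa Ua + Sy (L2 *m row_mx (W2 *m H2) 0).
  rewrite /Phi Sigma_blocks_perturb -[RHS]addrA -SyD -mulmxDr add_row_mx addr0.
  by [].
have GE : G_blocks U s alpha *m dsum14 D *m H_blocks U X V
  = L1 *m row_mx 0 (row_mx (W1 *m H1) 0) + dsum 0 (L2 *m row_mx (W2 *m H2) 0).
  rewrite /G_blocks /H_blocks -/H1 -/H2.
  rewrite -[X in X *m _]mulmxA [in X in _ *m X *m _]/dsum14 dsum_mul.
  rewrite !row7_dsum -/W1 -/W2.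
  have -> : col_mx (row_mx 1%:M 0)
      (col_mx (col_mx (row_mx (Col_alpha alpha) 0) (row_mx 0 (- (J2 s)^T)))
        (row_mx 0 (Jt s))) = row_mx L1 (col_mx 0 L2).
    by rewrite -block_mxEh block_mxEv -block_mxEh block_mxEv -block_mxEh block_mxEv.
  rewrite -mulmxA [dsum W1 W2 *m _]mulmxA /dsum mul_block_col !mul0mx addr0 add0r.
  have rowE k (W : 'M[R]_(k, nx + q)) : W *m row_mx (0 : 'M[R]_(_, n))
      (row_mx 1%:M (0 : 'M[R]_(_, m))) = row_mx 0 (row_mx W 0).
    by rewrite !mul_mx_row !mulmx0 mulmx1.
  rewrite mulmxA mul_row_col mulmxDl -[L1 *m _ *m _]mulmxA.
  rewrite -[col_mx 0 L2 *m _ *m _]mulmxA !rowE.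
  by rewrite [col_mx 0 L2 *m _]mul_col_row !mul0mx !mulmx0.
rewrite /Theta PhiE GE Pi_blocks_perturb.
rewrite -[- X]addr0 -add_row_mx mulmxDr !SyD -sym2_Sy.
rewrite -[X in sym2 X _ _]addr0 -[X in sym2 _ X _]addr0 sym2D.
rewrite addr0.
exact: addrACA.
Qed.

End perturbed_lmi.

Lemma Sy_sym (R : realType) k (A : 'M[R]_k) : (Sy A)^T = Sy A.
Proof. by apply/matrixP => i j; rewrite !mxE addrC. Qed.

Lemma sym3_ul_sym (R : realType) k1 k2 k3 (A : 'M[R]_k1) (B : 'M[R]_(k1, k2))
    (C : 'M[R]_(k1, k3)) (D : 'M[R]_k2) (E : 'M[R]_(k2, k3)) (G : 'M[R]_k3) :
  negdef (sym3 A B C D E G) -> A^T = A.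
Proof.
case=> /(congr1 -%R); rewrite linearN/= !opprK /sym3 {1 3}/sym2 tr_block_mx.
by case/eq_block_mx.
Qed.

Section robust_lmi.
Context {R : realType} {n m p q d : nat}.
Variables (P : plant R n m p q d) (U : uncertainty R n m p q d).
Variables (X : 'M[R]_n) (V : 'M[R]_(p, n)).
Variables (r : R) (f : R -> 'cV[R]_d) (M : 'M[R]_d).
Variables (s : supply_rate R m q) (alpha : 'I_(2 + d) -> R).
Variables (Pa : 'M[R]_n) (Qa : 'M[R]_(n, d * n)).
Variables (Ra : 'M[R]_(d * n)) (Sa Ua : 'M[R]_n).
Variables (k1 k2 : R).
Hypotheses (k1_gt0 : 0 < k1) (k2_gt0 : 0 < k2).
Hypothesis Xi_gt0 : forall i, posdef (uXi U i).
Hypothesis wp_lmi : well_posedness_lmi U k1.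
Hypothesis mn_lmi : main_lmi r f M P U s alpha Pa X V Qa Ra Sa Ua k2.
Variable Delta : perturbation U.
Hypothesis Delta_adm : admissible Delta.

Let N := dsum14 (fun i => invmx (uXi U i)).

Lemma admissible_dsum14 y :
  0 <= quad_form (uncertainty_form (dsum14 Delta) N (bJ2 U) (bJ3 U)) y.
Proof.
suff [] : possemidef (uncertainty_form (dsum14 Delta) N (bJ2 U) (bJ3 U)) by [].
rewrite /uncertainty_form /N /bJ2 /bJ3 /Sy.
rewrite !(dsum14_mul, dsum14_tr, dsum14D).
apply: dsum14_possemidef => i; move: (Delta_adm i).
rewrite /sym2 tr_col_mx trmx1 mul_row_block mul_row_col !mul1mx mulmx1.
by rewrite mulmxDl trmx_mul !addrA [invmx _ + _ + _]addrAC.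
Qed.

Let XiN : bJ1 U *m N = 1%:M.
Proof.
rewrite /bJ1 /N dsum14_mul -dsum14_1; apply: eq_dsum14 => i.
by rewrite mulmxV// posdef_unitmx.
Qed.

Let dsum14_well_posed : 1%:M - dsum14 Delta *m F_Delta U
  = dsum14 (fun i => 1%:M - Delta i *m uF U i).
Proof. by rewrite /F_Delta -dsum14_1 dsum14_mul dsum14N dsum14D. Qed.

(** The large inequality gives the inverse of the direct sum of the
    [1 - Delta_i F_i], hence of each of them. *)
Lemma admissible_well_posed : well_posed Delta.
Proof.
apply/dsum14_unitmx; rewrite -dsum14_well_posed.
exact: (well_posed_unitmx XiN admissible_dsum14 k1_gt0 wp_lmi).
Qed.

Lemma admissible_Theta_negdef :
  negdef (Theta r f M (perturb P Delta) s alpha Pa X V Qa Ra Sa Ua).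
Proof.
have wp := admissible_well_posed.
split=> [|z z0].
  by rewrite Theta_perturb linearN linearD/= (sym3_ul_sym mn_lmi) Sy_sym.
rewrite quad_formN oppr_gt0; move: z z0.
rewrite Theta_perturb -dsum14_mul -dsum14_inv// -dsum14_well_posed.
apply: (perturbed_negdef XiN admissible_dsum14 k2_gt0 _ mn_lmi).
by rewrite dsum14_well_posed; apply/dsum14_unitmx.
Qed.

End robust_lmi.

(** * One-sided derivatives *)

Section one_sided.
Context {R : realType}.
Implicit Types (D : set R) (t : R).

Lemma near_within_dnbhs D t (Q : R -> Prop) :
  (\forall s \near within D t^', Q s) <->
  exists2 e : R, 0 < e & forall s, `|s - t| < e -> s != t -> D s -> Q s.
Proof.
split=> [/nbhs_ballP[e /= e0 he]|[e e0 he]].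
  exists e => // s st nst Ds; apply: he => //.
  by rewrite /ball/= distrC.
apply/nbhs_ballP; exists e => //= s st nst Ds; apply: he => //.
by rewrite distrC.
Qed.

Lemma near_within_nbhs D t (Q : R -> Prop) : Q t ->
  (\forall s \near within D t^', Q s) -> \forall s \near within D (nbhs t), Q s.
Proof.
move=> Qt /near_within_dnbhs[e e0 he].
apply/nbhs_ballP; exists e => //= s st Ds.
have [->//|nst] := eqVneq s t; apply: he => //.
by rewrite distrC.
Qed.

Lemma has_derivative_on_entry k l D (g : R -> 'M[R]_(k, l)) t dg i j :
  has_derivative_on D g t dg ->
  has_derivative_on D (fun s => g s i j : R) t (dg i j).
Proof.
move=> gdg; rewrite /has_derivative_on.
have -> : (fun s => (s - t)^-1 *: (g s i j - g t i j)) =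
    (fun A : 'M[R]_(k, l) => A i j) \o (fun s => (s - t)^-1 *: (g s - g t)).
  by apply/funext => s /=; rewrite !mxE.
exact: (cvg_comp _ _ gdg (@coord_continuous _ _ _ i j dg)).
Qed.

Implicit Types f g : R -> R.

Lemma has_derivative_on_cvg_dnbhs D g t dg : has_derivative_on D g t dg ->
  g s @[s --> within D t^'] --> g t.
Proof.
move=> gdg.
have st0 : s - t @[s --> within D t^'] --> (0 : R).
  apply/cvgrPdist_lt => e e0; apply/near_within_dnbhs; exists e => // s st _ _.
  by rewrite sub0r normrN.
have : (s - t) * ((s - t)^-1 *: (g s - g t)) + g t @[s --> within D t^']
    --> 0 * dg + g t.
  by apply: cvgD; [exact: cvgM|exact: cvg_cst].
rewrite mul0r add0r; apply: cvg_trans; apply: near_eq_cvg.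
apply/near_within_dnbhs; exists 1 => // s _ nst _ /=.
by rewrite -[_ *: _]/(_^-1 * _) mulrA mulfV ?subr_eq0// mul1r subrK.
Qed.

Lemma has_derivative_on_cvg D g t dg : has_derivative_on D g t dg ->
  g s @[s --> within D (nbhs t)] --> g t.
Proof.
move=> /has_derivative_on_cvg_dnbhs/cvgrPdist_lt gt.
apply/cvgrPdist_lt => e e0; apply: near_within_nbhs; last exact: gt.
by rewrite subrr normr0.
Qed.

Lemma eq_has_derivative_on D f g t dg : {in D, f =1 g} -> D t ->
  has_derivative_on D f t dg -> has_derivative_on D g t dg.
Proof.
move=> fg Dt; apply: cvg_trans; apply: near_eq_cvg.
apply/near_within_dnbhs; exists 1 => // s _ _ Ds /=.
by rewrite !fg// inE.
Qed.

Lemma has_derivative_on_cst D (c t : R) : has_derivative_on D (fun=> c) t 0.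
Proof.
rewrite /has_derivative_on; under eq_fun do rewrite subrr scaler0.
exact: cvg_cst.
Qed.

Lemma has_derivative_onD D f g t df dg :
  has_derivative_on D f t df -> has_derivative_on D g t dg ->
  has_derivative_on D (fun s => f s + g s) t (df + dg).
Proof.
move=> ff gg; apply: cvg_trans (cvgD ff gg); apply: near_eq_cvg.
apply: nearW => s.
rewrite -[RHS]/((s - t)^-1 * (f s + g s - (f t + g t))).
by rewrite -[LHS]/((s - t)^-1 * (f s - f t) + (s - t)^-1 * (g s - g t)); ring.
Qed.

Lemma has_derivative_onM D f g t df dg :
  has_derivative_on D f t df -> has_derivative_on D g t dg ->
  has_derivative_on D (fun s => f s * g s) t (df * g t + f t * dg).
Proof.
move=> ff gg.
have gc := has_derivative_on_cvg_dnbhs gg.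
apply: cvg_trans (cvgD (cvgM ff gc) (cvgM (cvg_cst (f t)) gg)).
apply: near_eq_cvg; apply: nearW => s.
rewrite -[RHS]/((s - t)^-1 * (f s * g s - f t * g t)).
rewrite -[LHS]/((s - t)^-1 * (f s - f t) * g s
  + f t * ((s - t)^-1 * (g s - g t))).
ring.
Qed.

Lemma has_derivative_onZ D c f t df : has_derivative_on D f t df ->
  has_derivative_on D (fun s => c * f s) t (c * df).
Proof.
move=> ff; have := has_derivative_onM (has_derivative_on_cst D c t) ff.
by rewrite mul0r add0r.
Qed.

Lemma has_derivative_on_sum (I : Type) (s : seq I) D (f : I -> R -> R) t df :
  (forall i, has_derivative_on D (f i) t (df i)) ->
  has_derivative_on D (fun u => \sum_(i <- s) f i u) t (\sum_(i <- s) df i).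
Proof.
move=> ff; elim: s => [|i s IHs].
  under eq_fun do rewrite big_nil.
  by rewrite big_nil; exact: has_derivative_on_cst.
under eq_fun do rewrite big_cons.
by rewrite big_cons; apply: has_derivative_onD.
Qed.

Lemma is_derive_has_derivative_on D g t dg :
  is_derive t 1 g dg -> has_derivative_on D g t dg.
Proof.
case=> g_drv <-; move/cvgrPdist_lt: (g_drv) => hg.
apply/cvgrPdist_lt => e /hg /nbhs_ballP[d /= d0 hd].
apply/near_within_dnbhs; exists d => // s st nst Ds.
have := hd (s - t); rewrite /ball/= sub0r normrN => /(_ st).
rewrite /= subr_eq0 => /(_ nst).
by rewrite -[_ *: 1]/(_ * 1) mulr1 subrK.
Qed.

Lemma has_derivative_on_is_derive D g t dg : nbhs t D ->
  has_derivative_on D g t dg -> is_derive t 1 g dg.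
Proof.
move=> /nbhs_ballP[a /= a0 Da] /cvgrPdist_lt hg.
suff g_cvg : h^-1 *: (g (h *: 1 + t) - g t) @[h --> 0^'] --> dg.
  by split; [apply/cvg_ex; exists dg|exact: cvg_lim g_cvg].
apply/cvgrPdist_lt => e /hg /near_within_dnbhs[d d0 hd].
apply/nbhs_ballP; exists (Num.min a d) => [|h] /=.
  by rewrite lt_min a0.
rewrite /ball/= sub0r normrN lt_min => /andP[ha hd'] h0.
have := hd (h + t); rewrite addrK => /(_ hd'); rewrite -subr_eq0 addrK => /(_ h0).
rewrite -[h *: 1]/(h * 1) mulr1; apply; apply: Da.
by rewrite /ball/= opprD addrCA subrr addr0 normrN.
Qed.

End one_sided.

(** * Integrals of continuous functions over a segment *)

Section segment_integral.
Context {R : realType}.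
Notation mu := (@lebesgue_measure R).
Implicit Types (g h : R -> R).

Lemma within_continuous_integrable g (a b : R) :
  {within `[a, b], continuous g} -> mu.-integrable `[a, b] (EFin \o g).
Proof. by apply: continuous_compact_integrable; exact: segment_compact. Qed.

Lemma continuous_integrable g (a b : R) : continuous g ->
  mu.-integrable `[a, b] (EFin \o g).
Proof. by move=> cg; apply: within_continuous_integrable; exact: continuous_subspaceT. Qed.

Lemma within_continuous_bounded g (a b : R) : {within `[a, b], continuous g} ->
  exists2 B : R, 0 < B & forall t, a <= t <= b -> `|g t| <= B.
Proof.
move=> cg; have [ab|ab] := leP a b; last first.
  by exists 1 => // t /andP[at_ /(le_trans at_)]; rewrite leNgt ab.
have cng : {within `[a, b], continuous (fun t => `|g t|)}.
  by move=> t; apply: continuous_comp (cg t) (@norm_continuous _ _ _).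
have [c _ hc] := EVT_max ab cng.
exists (1 + `|g c|) => [|t tab]; first by rewrite ltr_pwDl.
by rewrite (le_trans (hc t _))// ?in_itv// lerDr.
Qed.

Lemma continuous_sum (I : Type) (s : seq I) (g : I -> R -> R) :
  (forall i, continuous (g i)) -> continuous (fun t => \sum_(i <- s) g i t).
Proof.
move=> cg; elim: s => [|i s IHs] t.
  by under eq_fun do rewrite big_nil; exact: cvg_cst.
by under eq_fun do rewrite big_cons; exact: cvgD (cg i t) (IHs t).
Qed.

Lemma Rintegral_sum_continuous (I : Type) (s : seq I) (g : I -> R -> R) (a b : R) :
  (forall i, continuous (g i)) ->
  \int[mu]_(t in `[a, b]) (\sum_(i <- s) g i t) =
  \sum_(i <- s) \int[mu]_(t in `[a, b]) g i t.
Proof.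
move=> cg; elim: s => [|i s IHs].
  under eq_Rintegral do rewrite big_nil.
  by rewrite big_nil Rintegral_cst// mul0r.
under eq_Rintegral do rewrite big_cons.
rewrite RintegralD ?IHs ?big_cons//; first exact: continuous_integrable.
by apply: continuous_integrable; exact: continuous_sum.
Qed.

Lemma Rintegral_le_bound g (a b B : R) : a <= b -> continuous g ->
  (forall t, a <= t <= b -> `|g t| <= B) ->
  `|\int[mu]_(t in `[a, b]) g t| <= B * (b - a).
Proof.
move=> ab cg gB; have ig := continuous_integrable a b cg.
apply: le_trans (le_normr_Rintegral _ ig) _ => //.
have -> : B * (b - a) = \int[mu]_(t in `[a, b]) B.
  rewrite Rintegral_cst//= lebesgue_measure_itv/= lte_fin.
  move: ab; rewrite le_eqVlt => /predU1P[->|->]; last by rewrite -EFinD.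
  by rewrite ltxx subrr.
apply: le_Rintegral => //.
- apply: (continuous_integrable (g := fun t => `|g t|)) => t.
  exact: continuous_comp (cg t) (@norm_continuous _ _ _).
- by apply: (continuous_integrable (g := cst B)); exact: cst_continuous.
Qed.

Lemma is_derive_primitive g (a t : R) : continuous g -> a < t ->
  is_derive t (1 : R) (fun u => \int[mu]_(v in `[a, u]) g v) (g t).
Proof.
move=> cg at_; have tt1 : t < t + 1 by rewrite ltrDl.
have [dF <-] := continuous_FTC1_closed tt1 (continuous_integrable a (t + 1) cg) at_ (cg t).
by rewrite derive1E; exact: DeriveDef.
Qed.

Lemma derivable_LRcontinuous g (a b : R) : a < b ->
  {in `[a, b], forall t, derivable g t 1} -> derivable_oo_LRcontinuous g a b.
Proof.
move=> ab dg; have cg := derivable_within_continuous dg.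
have /continuous_within_itvP-/(_ ab)[_ cl cr] := cg; split=> // t tab.
exact: dg (subset_itv_oo_cc tab).
Qed.

(** The antiderivative [y] of [h] turns the window integral of [a] against [h]
    into boundary terms and the integral of [a'] against [y]; only the latter
    has to be differentiated under the integral sign, and there the integrand
    is continuously differentiable in the position of the window, although [h]
    is merely continuous. *)
Lemma is_derive_window_integral (r : R) (a a1 h : R -> R) (t : R) : 0 < r ->
  {in `[- r, 0], forall tau, has_derivative_on `[- r, 0] a tau (a1 tau)} ->
  {within `[- r, 0], continuous a1} -> continuous h ->
  is_derive t (1 : R) (fun t' => \int[mu]_(tau in `[- r, 0]) (a tau * h (t' + tau)))
    (a 0 * h t - a (- r) * h (t - r)
     - \int[mu]_(tau in `[- r, 0]) (a1 tau * h (t + tau))).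
Proof.
move=> r0 da ca1 ch.
(* the base point lies below t - r - 1, out of reach of the windows near t *)
pose c := t - r - 2.
pose y s := \int[mu]_(v in `[c, s]) h v.
have dy (s : R) : c < s -> is_derive s (1 : R) y (h s).
  by move=> cs; exact: is_derive_primitive.
clearbody y.
have ca : {within `[- r, 0], continuous a}.
  apply/subspace_continuousP => tau taur.
  exact: has_derivative_on_cvg (da _ taur).
have cshift (k : R) : continuous (fun tau => h (k + tau)).
  move=> tau; apply: continuous_comp (ch _).
  by apply: cvgD; [exact: cvg_cst|exact: cvg_id].
have Nr0 : - r < 0 by rewrite oppr_lt0.
have dyshift (k tau : R) : t - 1 < k -> k < t + 1 -> tau \in `[- r, 0] ->
    is_derive tau (1 : R) (fun tau => y (k + tau)) (h (k + tau)).
  rewrite in_itv/= => tk kt /andP[rtau tau0].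
  have dyk : is_derive (k + tau) (1 : R) y (h (k + tau)).
    by apply: dy; rewrite /c; lra.
  have dk : is_derive tau (1 : R) (fun tau => k + tau) 1.
    rewrite -[X in is_derive _ _ _ X]add0r.
    exact: (is_deriveD (is_derive_cst k tau 1) (is_derive_id tau 1)).
  have := is_derive1_comp dyk dk.
  by rewrite mulr1.
have parts (k : R) : t - 1 < k -> k < t + 1 ->
    \int[mu]_(tau in `[- r, 0]) (a tau * h (k + tau)) =
    a 0 * y k - a (- r) * y (k - r)
    - \int[mu]_(tau in `[- r, 0]) (a1 tau * y (k + tau)).
  move=> tk kt.
  rewrite (@Rintegration_by_parts R a (fun tau => y (k + tau)) a1
    (fun tau => h (k + tau)))//.
  - by rewrite addr0.
  - have /continuous_within_itvP-/(_ Nr0)[_ cl cr] := ca; split=> // tau tauoo.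
    have := da tau (subset_itv_oo_cc tauoo).
    have taunbhs : nbhs tau `[- r, 0]%classic.
      apply: filterS (near_in_itvoo tauoo) => z.
      by rewrite inE; exact: subset_itv_oo_cc.
    by move=> /(has_derivative_on_is_derive taunbhs)[].
  - move=> tau tauoo.
    have := da tau (subset_itv_oo_cc tauoo).
    have taunbhs : nbhs tau `[- r, 0]%classic.
      apply: filterS (near_in_itvoo tauoo) => z.
      by rewrite inE; exact: subset_itv_oo_cc.
    by rewrite derive1E; move=> /(has_derivative_on_is_derive taunbhs)[_ ->].
  - exact: continuous_subspaceT.
  - apply: derivable_LRcontinuous => // tau taucc.
    by have [] := dyshift k tau tk kt taucc.
  - move=> tau tauoo; rewrite derive1E.
    by have [] := dyshift k tau tk kt (subset_itv_oo_cc tauoo).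
have under_int : is_derive t (1 : R)
    (fun k => \int[mu]_(tau in `[- r, 0]) (a1 tau * y (k + tau)))
    (\int[mu]_(tau in `[- r, 0]) (a1 tau * h (t + tau))).
  have dpar (k tau : R) : t - 1 < k -> k < t + 1 -> tau \in `[- r, 0] ->
      is_derive k (1 : R) (fun k => a1 tau * y (k + tau)) (a1 tau * h (k + tau)).
    move=> tk kt; rewrite in_itv/= => /andP[rtau tau0].
    have d1 : is_derive (k + tau) (1 : R) y (h (k + tau)).
      by apply: dy; rewrite /c; lra.
    have d2 : is_derive k (1 : R) (fun k => k + tau) 1.
      rewrite -[X in is_derive _ _ _ X]addr0.
      exact: (is_deriveD (is_derive_id k 1) (is_derive_cst tau k 1)).
    have := @is_derive1_comp R y (fun k => k + tau) k _ _ d1 d2.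
    by rewrite mulr1 => d3; exact: (is_deriveZ (a1 tau) d3).
  have [Ba Ba0 a1B] := within_continuous_bounded ca1.
  have [Bh Bh0 hB] := within_continuous_bounded
    (continuous_subspaceT (A := `[t - 1 - r, t + 1]%classic) ch).
  have tI : `]t - 1, t + 1[%classic t by rewrite /= in_itv/=; apply/andP; split; lra.
  have := @cvg_differentiation_under_integral R _ _ mu
    (fun k tau => a1 tau * y (k + tau)) `[- r, 0]%classic (measurable_itv _)
    t (t - 1) (t + 1) tI _ _ (cst (Ba * Bh)).
  have dE (k tau : R) : k \in `]t - 1, t + 1[ -> tau \in `[- r, 0] ->
      partial1of2 (fun k tau => a1 tau * y (k + tau)) k tau = a1 tau * h (k + tau).
    rewrite in_itv/= => /andP[tk kt] taur; rewrite partial1of2E.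
    by have [_ ->] := dpar k tau tk kt taur.
  have -> : \int[mu]_(tau in `[- r, 0]) partial1of2
      (fun k tau => a1 tau * y (k + tau)) t tau
    = \int[mu]_(tau in `[- r, 0]) (a1 tau * h (t + tau)).
    by apply: eq_Rintegral => tau; rewrite inE => taur; exact: dE.
  move=> cvgI; have {}cvgI : h^-1 *: (
     (\int[mu]_(tau in `[- r, 0]) (a1 tau * y (h *: 1 + t + tau)))
     - (\int[mu]_(tau in `[- r, 0]) (a1 tau * y (t + tau)))) @[h --> 0^']
     --> \int[mu]_(tau in `[- r, 0]) (a1 tau * h (t + tau)).
    under eq_fun do rewrite -[_ *: 1]/(_ * 1) mulr1.
    apply: cvgI => //.
    - move=> k; rewrite /= in_itv/= => /andP[tk kt].
      apply: within_continuous_integrable => tau.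
      apply: cvgM; first exact: ca1.
      move: tau; apply: derivable_within_continuous => tau taur.
      by have [] := dyshift k tau tk kt taur.
    - move=> k tau; rewrite /= in_itv/= => /andP[tk kt] taur.
      by have [] := dpar k tau tk kt taur.
    - by move=> _ /=; rewrite mulr_ge0// ltW.
    - by apply: (continuous_integrable (g := cst _)); exact: cst_continuous.
    - move=> k tau kI taur; rewrite dE// normrM ler_pM// ?a1B ?hB//.
      move: kI taur; rewrite /= !in_itv/= => /andP[? ?] /andP[? ?].
      by apply/andP; split; lra.
  by split; [apply/cvg_ex; eexists; exact: cvgI|exact: cvg_lim cvgI].
apply: (@near_eq_is_derive _ _ _ (fun k => a 0 * y k - a (- r) * y (k - r)
    - \int[mu]_(tau in `[- r, 0]) (a1 tau * y (k + tau)))).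
  near=> k; rewrite parts//; near: k.
    by apply: lt_nbhsr; rewrite gtrBl.
  by apply: lt_nbhsl; rewrite ltrDl.
have dyt : is_derive t (1 : R) y (h t) by apply: dy; rewrite /c; lra.
have dytr : is_derive t (1 : R) (fun k => y (k - r)) (h (t - r)).
  have d1 : is_derive (t - r) (1 : R) y (h (t - r)) by apply: dy; rewrite /c; lra.
  have d2 : is_derive t (1 : R) (fun k => k - r) 1.
    rewrite -[X in is_derive _ _ _ X]subr0.
    exact: (is_deriveB (is_derive_id t 1) (is_derive_cst r t 1)).
  by have := @is_derive1_comp R y (fun k => k - r) t _ _ d1 d2; rewrite mulr1.
exact: is_deriveB.
Unshelve. all: by end_near. Qed.

End segment_integral.

(** * Bounded quadratic functionals *)

Section quadratic.
Context {R : realType} {V : normedModType R}.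
Variables (B : V -> V -> R) (C : R).
Hypothesis BDl : forall a x y z, B (a *: x + y) z = a * B x z + B y z.
Hypothesis BDr : forall a x y z, B z (a *: x + y) = a * B z x + B z y.
Hypothesis B_bound : forall x y, `|B x y| <= C * `|x| * `|y|.

(** The remainder of the linearization at [x] is [B h h], which is quadratic. *)
Lemma bounded_quadratic_differentiable x : differentiable (fun y => B y y) x.
Proof.
pose D h := B x h + B h x.
have linD : linear (D : V -> R^o).
  by move=> a h k; rewrite /D BDl BDr /= -[_ *: _]/(a * _); ring.
pose dlM := GRing.isLinear.Build _ _ _ _ _ linD.
pose dL : {linear V -> R^o} := HB.pack D dlM.
have C0 : 0 <= `|C| by [].
have dLc : continuous dL.
  apply: bounded_linear_continuous.
  apply/linear_boundedP; exists (2 * (`|C| * `|x|)); split; first exact: num_real.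
  move=> M hM h; rewrite /= /D (le_trans (ler_normD _ _))//.
  have h1 := B_bound x h; have h2 := B_bound h x.
  have h3 : C * `|x| * `|h| <= `|C| * `|x| * `|h| by rewrite !ler_wpM2r// ler_norm.
  have h4 : C * `|h| * `|x| = C * `|x| * `|h| by ring.
  have h5 : 2 * (`|C| * `|x|) * `|h| <= M * `|h| by rewrite ler_wpM2r// ltW.
  lra.
have expand h : B (h + x) (h + x) = B x x + D h + B h h.
  have e y z : B (y + z) = (fun u => B y u + B z u).
    by apply/funext => u; rewrite -{1}[y]scale1r BDl mul1r.
  have e' y z u : B u (y + z) = B u y + B u z.
    by rewrite -{1}[y]scale1r BDr mul1r.
  by rewrite e !e' /D; ring.
have little : (fun y => B y y) \o shift x = cst (B x x) + dL +o_ 0 id.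
  apply/eqaddoP => _ /posnumP[e].
  apply/nbhs_norm0P; exists (e%:num / (`|C| + 1)) => [|h] /=.
    by rewrite divr_gt0// ltr_pwDr.
  rewrite ltr_pdivlMr ?ltr_pwDr// => hh.
  rewrite -[X in `|X|]/(B (h + x) (h + x) - (B x x + D h)) expand addrAC subrr add0r.
  apply: le_trans (B_bound h h) _; rewrite ler_wpM2r//.
  have : C * `|h| <= `|C| * `|h| by rewrite ler_wpM2r// ler_norm.
  have : 0 <= `|h| by [].
  lra.
by apply/diff_locallyP; rewrite (diff_unique dLc little).
Qed.

End quadratic.

(** * Integrals of continuous matrix-valued functions *)

Section matrix_functions.
Context {R : realType}.
Notation mu := (@lebesgue_measure R).

Definition entrywise_continuous {k l} (g : R -> 'M[R]_(k, l)) : Prop :=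
  forall i j, continuous (fun t => g t i j : R).

Lemma continuous_entrywise k l (g : R -> 'M[R]_(k, l)) :
  continuous g -> entrywise_continuous g.
Proof.
move=> cg i j t.
exact: (cvg_comp _ _ (cg t) (@coord_continuous _ _ _ i j (g t))).
Qed.

Lemma entrywise_continuous_cst k l (A : 'M[R]_(k, l)) :
  entrywise_continuous (fun=> A).
Proof. by move=> i j; exact: cst_continuous. Qed.

Lemma entrywise_continuousM k l o (g : R -> 'M[R]_(k, l)) (h : R -> 'M[R]_(l, o)) :
  entrywise_continuous g -> entrywise_continuous h ->
  entrywise_continuous (fun t => g t *m h t).
Proof.
move=> cg ch i j; under eq_fun do rewrite mxE.
by apply: continuous_sum => a t; exact: cvgM (cg i a t) (ch a j t).
Qed.

Lemma entrywise_continuousMl k l o (A : 'M[R]_(k, l)) (g : R -> 'M[R]_(l, o)) :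
  entrywise_continuous g -> entrywise_continuous (fun t => A *m g t).
Proof.
move=> cg; apply: (@entrywise_continuousM _ _ _ (fun=> A)) => //.
exact: entrywise_continuous_cst.
Qed.

Lemma entrywise_continuousMr k l o (A : 'M[R]_(l, o)) (g : R -> 'M[R]_(k, l)) :
  entrywise_continuous g -> entrywise_continuous (fun t => g t *m A).
Proof.
move=> cg; apply: (@entrywise_continuousM _ _ _ _ (fun=> A)) => //.
exact: entrywise_continuous_cst.
Qed.

Lemma entrywise_continuousD k l (g h : R -> 'M[R]_(k, l)) :
  entrywise_continuous g -> entrywise_continuous h ->
  entrywise_continuous (fun t => g t + h t).
Proof.
move=> cg ch i j; under eq_fun do rewrite mxE.
by move=> t; exact: cvgD (cg i j t) (ch i j t).
Qed.

Lemma entrywise_continuous_tr k l (g : R -> 'M[R]_(k, l)) :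
  entrywise_continuous g -> entrywise_continuous (fun t => (g t)^T).
Proof. by move=> cg i j; under eq_fun do rewrite mxE; exact: cg. Qed.

Lemma entrywise_continuous_tensI l k (g : R -> 'cV[R]_l) :
  entrywise_continuous g -> entrywise_continuous (fun t => tensI (g t) k).
Proof.
move=> cg a j; case: (mxtens_indexP a) => i i'.
under eq_fun do rewrite tensIE.
by move=> t; exact: cvgM (cg i 0 t) (cvg_cst _).
Qed.

Lemma entrywise_continuous_shift k l (g : R -> 'M[R]_(k, l)) (c : R) :
  entrywise_continuous g -> entrywise_continuous (fun t => g (c + t)).
Proof.
move=> cg i j t; apply: (@continuous_comp _ _ _ (+%R c) (fun t => g t i j)).
  by apply: cvgD; [exact: cvg_cst|exact: cvg_id].
exact: cg.
Qed.

Lemma dot_continuous k (g h : R -> 'cV[R]_k) : entrywise_continuous g ->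
  entrywise_continuous h -> continuous (fun t => dot (g t) (h t)).
Proof.
move=> cg ch; apply: (entrywise_continuousM _ ch).
exact: entrywise_continuous_tr.
Qed.

Variables (a b : R).

Lemma eq_mx_integral k l (g h : R -> 'M[R]_(k, l)) :
  {in `[a, b], g =1 h} -> mx_integral a b g = mx_integral a b h.
Proof.
move=> gh; apply/matrixP => i j; rewrite !mxE.
by apply: eq_Rintegral => t; rewrite inE => tab; rewrite gh.
Qed.

Lemma mx_integralMl k l o (A : 'M[R]_(k, l)) (g : R -> 'M[R]_(l, o)) :
  entrywise_continuous g ->
  mx_integral a b (fun t => A *m g t) = A *m mx_integral a b g.
Proof.
move=> cg; apply/matrixP => i j; rewrite !mxE.
under eq_Rintegral do rewrite mxE.
rewrite Rintegral_sum_continuous => [|c t]; last exact: cvgM (cvg_cst _) (cg c j t).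
by apply: eq_bigr => c _; rewrite mxE RintegralZl//; exact: continuous_integrable.
Qed.

Lemma mx_integral_tr k l (g : R -> 'M[R]_(k, l)) :
  mx_integral a b (fun t => (g t)^T) = (mx_integral a b g)^T.
Proof.
by apply/matrixP => i j; rewrite !mxE; under eq_Rintegral do rewrite mxE.
Qed.

Lemma mx_integralMr k l o (A : 'M[R]_(l, o)) (g : R -> 'M[R]_(k, l)) :
  entrywise_continuous g ->
  mx_integral a b (fun t => g t *m A) = mx_integral a b g *m A.
Proof.
move=> /entrywise_continuous_tr/(mx_integralMl A^T) gA.
apply: trmx_inj; rewrite trmx_mul -!mx_integral_tr -gA.
by apply: eq_mx_integral => t _; rewrite trmx_mul.
Qed.

Lemma mx_integralD k l (g h : R -> 'M[R]_(k, l)) :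
  entrywise_continuous g -> entrywise_continuous h ->
  mx_integral a b (fun t => g t + h t) = mx_integral a b g + mx_integral a b h.
Proof.
move=> cg ch; apply/matrixP => i j; rewrite !mxE.
under eq_Rintegral do rewrite mxE.
by rewrite RintegralD//; exact: continuous_integrable.
Qed.

Lemma mx_integral_tens k l o o' (S : 'M[R]_(o, o')) (g : R -> 'M[R]_(k, l)) :
  entrywise_continuous g ->
  mx_integral a b (fun t => g t *t S) = mx_integral a b g *t S.
Proof.
move=> cg; apply/matrixP => i j.
case: (mxtens_indexP i) => i0 i1; case: (mxtens_indexP j) => j0 j1.
rewrite tensmxE !mxE; under eq_Rintegral do rewrite tensmxE.
by rewrite RintegralZr//; exact: continuous_integrable.
Qed.

Lemma dot_mx_integral k (u : 'cV[R]_k) (g : R -> 'cV[R]_k) :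
  entrywise_continuous g ->
  \int[mu]_(t in `[a, b]) dot u (g t) = dot u (mx_integral a b g).
Proof.
move=> cg; rewrite /dot -mx_integralMl// mxE.
by apply: eq_Rintegral.
Qed.

End matrix_functions.

Section bessel.
Context {R : realType}.
Notation mu := (@lebesgue_measure R).
Variables (a b : R) (d n : nat) (f : R -> 'cV[R]_d) (S : 'M[R]_n).
Hypothesis f_cont : entrywise_continuous f.
Let Gm := mx_integral a b (fun tau => f tau *m (f tau)^T).
Hypothesis Gm_unit : Gm \in unitmx.
Hypothesis S_ge0 : possemidef S.

Let gram_sym : Gm^T = Gm.
Proof.
rewrite /Gm -mx_integral_tr; apply: eq_mx_integral => t _.
by rewrite trmx_mul trmxK.
Qed.

(** A vector form of Bessel's inequality: [c] is the orthogonal projection of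
    [y], coordinate by coordinate, on the span of the entries of [f]. The
    integrals of [c^T S y] and [c^T S c] are both equal to the left-hand side,
    and the form of [S] along [y - c] has a nonnegative integral. *)
Lemma integral_quad_form_ge (y : R -> 'cV[R]_n) : entrywise_continuous y ->
  quad_form (invmx Gm *t S) (mx_integral a b (fun tau => tensI (f tau) n *m y tau))
  <= \int[mu]_(tau in `[a, b]) quad_form S (y tau).
Proof.
move=> y_cont; set z := mx_integral _ _ _; have [S_sym S_pos] := S_ge0.
have Fy_cont : entrywise_continuous (fun tau => tensI (f tau) n *m y tau).
  by apply: entrywise_continuousM => //; exact: entrywise_continuous_tensI.
pose N := invmx Gm.
have N_sym : N^T = N by rewrite /N trmx_inv gram_sym.
pose c tau := (tensI (N *m f tau) n)^T *m z.
have c_cont : entrywise_continuous c.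
  apply/entrywise_continuousMr/entrywise_continuous_tr/entrywise_continuous_tensI.
  exact: entrywise_continuousMl.
have cSy tau : dot (c tau) (S *m y tau) =
    dot z ((N *t S) *m (tensI (f tau) n *m y tau)).
  by rewrite /c dot_mull trmxK !mulmxA tens_mul_tensI.
have cSc tau : dot (c tau) (S *m c tau) =
    dot z ((((N *t 1%:M) *m ((f tau *m (f tau)^T) *t S)) *m (N *t 1%:M)) *m z).
  rewrite /c dot_mull trmxK !mulmxA tensI_mul_tr trmx_mul N_sym.
  by rewrite !tensmx_mul mul1mx mulmx1 !mulmxA.
have yy_cont : continuous (fun tau => quad_form S (y tau)).
  under eq_fun do rewrite quad_formE; apply: dot_continuous => //.
  exact: entrywise_continuousMl.
have cy_cont : continuous (fun tau => dot (c tau) (S *m y tau)).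
  apply: dot_continuous => //.
  exact: entrywise_continuousMl.
have cc_cont : continuous (fun tau => dot (c tau) (S *m c tau)).
  apply: dot_continuous => //.
  exact: entrywise_continuousMl.
have icy : \int[mu]_(tau in `[a, b]) dot (c tau) (S *m y tau)
    = quad_form (N *t S) z.
  under eq_Rintegral do rewrite cSy.
  rewrite dot_mx_integral ?mx_integralMl// ?quad_formE//.
  exact: entrywise_continuousMl.
have icc : \int[mu]_(tau in `[a, b]) dot (c tau) (S *m c tau)
    = quad_form (N *t S) z.
  have ff_cont : entrywise_continuous (fun tau => f tau *m (f tau)^T).
    by apply: entrywise_continuousM => //; exact: entrywise_continuous_tr.
  have ffS_cont : entrywise_continuous (fun tau => (f tau *m (f tau)^T) *t S).
    move=> i j; under eq_fun do rewrite mxE.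
    by move=> t; exact: cvgM (ff_cont _ _ t) (cvg_cst _).
  have NffS_cont : entrywise_continuous
      (fun tau => (N *t 1%:M) *m ((f tau *m (f tau)^T) *t S)).
    exact: entrywise_continuousMl.
  have NffSN_cont : entrywise_continuous
      (fun tau => (N *t 1%:M) *m ((f tau *m (f tau)^T) *t S) *m (N *t 1%:M)).
    exact: entrywise_continuousMr.
  under eq_Rintegral do rewrite cSc.
  rewrite dot_mx_integral; last first.
    exact: entrywise_continuousMr.
  rewrite mx_integralMr// mx_integralMr// mx_integralMl// mx_integral_tens//.
  by rewrite -/Gm !tensmx_mul mulVmx// mul1mx mulmx1 mul1mx quad_formE.
have : 0 <= \int[mu]_(tau in `[a, b]) quad_form S (y tau - c tau).
  by apply: Rintegral_ge0.
have -> : \int[mu]_(tau in `[a, b]) quad_form S (y tau - c tau) =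
    \int[mu]_(tau in `[a, b]) (quad_form S (y tau)
      + (-2 * dot (c tau) (S *m y tau) + dot (c tau) (S *m c tau))).
  apply: eq_Rintegral => tau _; rewrite !quad_formE mulmxBr !dotrules.
  rewrite [dot (y tau) (S *m c tau)]quad_formS//; ring.
have iyy := continuous_integrable a b yy_cont.
have iccy := continuous_integrable a b cy_cont.
have iccc := continuous_integrable a b cc_cont.
have c2_cont : continuous (fun tau => -2 * dot (c tau) (S *m y tau)).
  by move=> t; exact: cvgM (cvg_cst _) (cy_cont t).
have i2 := continuous_integrable a b c2_cont.
rewrite RintegralD//; last first.
  apply: (continuous_integrable (g := fun tau => _ + _)) => t.
  exact: cvgD (c2_cont t) (cc_cont t).
rewrite RintegralD// RintegralZl// icy icc; lra.
Qed.

End bessel.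

(** * The main inequality along a trajectory *)

Section dissipation_inequality.
Context {R : realType} {n m p q d : nat}.
Variables (r : R) (f : R -> 'cV[R]_d) (M : 'M[R]_d).
Variables (P : plant R n m p q d) (s : supply_rate R m q).
Variables (alpha : 'I_(2 + d) -> R).
Variables (Pa X : 'M[R]_n) (V : 'M[R]_(p, n)) (Qa : 'M[R]_(n, d * n)).
Variables (Ra : 'M[R]_(d * n)) (Sa Ua : 'M[R]_n).
Hypotheses (Ra_sym : Ra^T = Ra) (J1_unit : J1 s \in unitmx).

(** The time derivative of [weighted_window], see [is_derive_weighted_window]. *)
Definition window_derivative (x1 x2 : 'cV[R]_n) (x3 : 'cV[R]_(d * n)) :=
  tensI (f 0) n *m x1 - tensI (f (- r)) n *m x2 - (M *t 1%:M) *m x3.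

Definition scaled_rhs (x1 x2 : 'cV[R]_n) (x3 : 'cV[R]_(d * n)) (w : 'cV[R]_q) :=
  (A1 P *m X + B1 P *m V) *m x1 + (A2 P *m X + B2 P *m V) *m x2
  + (A3 P *m ((1%:M : 'M[R]_d) *t X) + B3 P *m ((1%:M : 'M[R]_d) *t V)) *m x3
  + D1 P *m w.

Definition scaled_output (x1 x2 : 'cV[R]_n) (x3 : 'cV[R]_(d * n)) (w : 'cV[R]_q) :=
  (C1 P *m X + B4 P *m V) *m x1 + (C2 P *m X + B5 P *m V) *m x2
  + (C3 P *m ((1%:M : 'M[R]_d) *t X) + B6 P *m ((1%:M : 'M[R]_d) *t V)) *m x3
  + D2 P *m w.

Variables (dx x1 x2 : 'cV[R]_n) (x3 : 'cV[R]_(d * n)) (w : 'cV[R]_q).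
Hypothesis dx_eq : X *m dx = scaled_rhs x1 x2 x3 w.
Let z := scaled_output x1 x2 x3 w.
Let e := window_derivative x1 x2 x3.

(** Its last entry is the stationary point [c] of [c^T J1 c + 2 c^T Jt z], where
    this expression is the opposite of the first term of the supply rate: the
    Schur complement that makes the inequality linear in [Jt z] is undone. *)
Definition trajectory_vector : 'cV[R]_(n + ((n + (n + d * n)) + q + m)) :=
  col_mx dx (col_mx (col_mx (col_mx x1 (col_mx x2 x3)) w)
    (- (invmx (J1 s) *m (Jt s *m z)))).

(** The column of the [alpha_i] multiplies the difference between the right-hand
    side of the closed loop and [X dx], which vanishes along trajectories; the
    other summands of [Theta] assemble into the right-hand side. *)
Lemma quad_form_Theta :
  quad_form (Theta r f M P s alpha Pa X V Qa Ra Sa Ua) trajectory_vector =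
  2 * dot (col_mx dx e) (sym2 Pa Qa Ra *m col_mx x1 x3)
  + (quad_form Sa x1 + r * quad_form Ua x1) - quad_form Sa x2
  - quad_form (sfF r f *t Ua) x3 - supply s z w.
Proof.
rewrite /Theta quad_formD quad_form_Sy /trajectory_vector.
set xi := col_mx (col_mx _ _) _.
have PiE : Pi_blocks P X V *m xi = X *m dx.
  rewrite dx_eq Pi_blocksE /xi !mul_row_col mul0mx addr0 /scaled_rhs.
  by rewrite !addrA.
have SigmaE : row_mx (Sigma_blocks P X V) (0 : 'M[R]_m) *m xi = z.
  rewrite /Sigma_blocks /xi !mul_row_col mul0mx addr0 /z /scaled_output.
  by rewrite !addrA.
have FE : row_mx (@F_blocks R n q d r f M) (0 : 'M[R]_(d * n, m)) *m xi = e.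
  rewrite /F_blocks /xi !mul_row_col !mul0mx !addr0 /e /window_derivative.
  by rewrite !mulNmx !addrA.
clearbody z e.
rewrite -mulmxA [row_mx (- X) _ *m _]mul_row_col mulNmx PiE addNr mulmx0.
rewrite dot0r mulr0 add0r.
rewrite quad_form_sym2 quad_formE mul0mx dot0r add0r.
rewrite /Phi 2!quad_formD !quad_form_Sy -!mulmxA FE SigmaE.
rewrite /P_blocks /xi !mul_row_col !mul0mx !addr0 add0r.
rewrite !mul_col_mx !mul0mx !dot_col !dot0r !addr0 !add0r.
rewrite !quad_form_dsum quad_formD !quad_formN quad_formZ.
rewrite !mul_row_col !dotDr.
rewrite /supply quad_form_sym2 !quad_formE.
set u := Jt s *m z.
rewrite mulNmx mulmxN mulKVmx// !dotrules opprK.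
have -> : dot w ((J2 s)^T *m z) = dot z (J2 s *m w) by rewrite dot_trmx.
have -> : dot z ((Jt s)^T *m invmx (J1 s) *m Jt s *m z) = dot (invmx (J1 s) *m u) u.
  by rewrite -!mulmxA dot_trmx.
rewrite [dot e (Qa^T *m x1)]dot_trmx [dot e (Ra *m x3)]quad_formS//.
ring.
Qed.

End dissipation_inequality.

(** * The Lyapunov functional along a trajectory *)

Section quad_form_derivative.
Context {R : realType}.

Lemma quad_form_continuous k (A : 'M[R]_k) (g : R -> 'cV[R]_k) :
  entrywise_continuous g -> continuous (fun t => quad_form A (g t)).
Proof.
move=> cg; under eq_fun do rewrite quad_formE; apply: dot_continuous => //.
exact: entrywise_continuousMl.
Qed.

Lemma has_derivative_on_mulmx k l D (A : 'M[R]_(k, l)) (g : R -> 'cV[R]_l) t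
    (dg : 'cV[R]_l) :
  (forall i, has_derivative_on D (fun s => g s i 0 : R) t (dg i 0)) ->
  forall i, has_derivative_on D (fun s => (A *m g s) i 0 : R) t ((A *m dg) i 0).
Proof.
move=> dgi i; rewrite mxE.
have -> : (fun s => (A *m g s) i 0) = (fun s => \sum_j A i j * g s j 0).
  by apply/funext => s; rewrite mxE.
by apply: has_derivative_on_sum => j; exact: has_derivative_onZ.
Qed.

Lemma has_derivative_on_dot k D (g h : R -> 'cV[R]_k) t (dg dh : 'cV[R]_k) :
  (forall i, has_derivative_on D (fun s => g s i 0 : R) t (dg i 0)) ->
  (forall i, has_derivative_on D (fun s => h s i 0 : R) t (dh i 0)) ->
  has_derivative_on D (fun s => dot (g s) (h s)) t (dot dg (h t) + dot (g t) dh).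
Proof.
move=> dgi dhi.
under eq_fun do rewrite dotE.
rewrite !dotE -big_split/=.
by apply: has_derivative_on_sum => j; exact: has_derivative_onM.
Qed.

Lemma has_derivative_on_quad_form k D (A : 'M[R]_k) (g : R -> 'cV[R]_k) t
    (dg : 'cV[R]_k) :
  A^T = A ->
  (forall i, has_derivative_on D (fun s => g s i 0 : R) t (dg i 0)) ->
  has_derivative_on D (fun s => quad_form A (g s)) t (2 * dot dg (A *m g t)).
Proof.
move=> sA dgi; under eq_fun do rewrite quad_formE.
have := has_derivative_on_dot dgi (has_derivative_on_mulmx (A := A) dgi).
by rewrite [dot (g t) (A *m dg)]quad_formS// mulrDl mul1r.
Qed.

End quad_form_derivative.

Section functional.
Context {R : realType} {n d : nat}.
Notation mu := (@lebesgue_measure R).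
Variables (r : R) (f : R -> 'cV[R]_d) (M : 'M[R]_d).
Hypothesis r_gt0 : 0 < r.
Hypothesis f_cont : entrywise_continuous f.
Hypothesis f_ode : forall tau : R, tau \in `[- r, 0] ->
  has_derivative_on `[- r, 0] f tau (M *m f tau).
Implicit Types y z : R -> 'cV[R]_n.

Definition weighted_window y (t : R) : 'cV[R]_(d * n) :=
  mx_integral (- r) 0 (fun tau => tensI (f tau) n *m y (t + tau)).

Lemma entrywise_continuous_window y (t : R) : entrywise_continuous y ->
  entrywise_continuous (fun tau => tensI (f tau) n *m y (t + tau)).
Proof.
move=> cy; apply: entrywise_continuousM; first exact: entrywise_continuous_tensI.
exact: entrywise_continuous_shift.
Qed.

Lemma is_derive_weighted_window y (t : R) k : entrywise_continuous y ->
  is_derive t (1 : R) (fun t' => weighted_window y t' k 0 : R)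
    (window_derivative r f M (y t) (y (t - r)) (weighted_window y t) k 0).
Proof.
move=> cy; case: (mxtens_indexP k) => i j; rewrite /window_derivative.
have -> : (fun t' => weighted_window y t' (mxtens_index (i, j)) 0 : R) =
    (fun t' => \int[mu]_(tau in `[- r, 0]) (f tau i 0 * y (t' + tau) j 0)).
  apply/funext => t'; rewrite mxE; apply: eq_Rintegral => tau _.
  by rewrite mul_tensI.
have -> : (M *t 1%:M) *m weighted_window y t =
    mx_integral (- r) 0 (fun tau => tensI (M *m f tau) n *m y (t + tau)).
  rewrite -mx_integralMl; last exact: entrywise_continuous_window.
  by apply: eq_mx_integral => tau _; rewrite mulmxA tens_mul_tensI mulmx1.
rewrite mxE [X in _ + X]mxE [X in X - _]mxE [X in _ + X - _]mxE !mul_tensI mxE.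
have -> : \int[mu]_(tau in `[- r, 0])
      (tensI (M *m f tau) n *m y (t + tau)) (mxtens_index (i, j)) 0 =
    \int[mu]_(tau in `[- r, 0]) ((M *m f tau) i 0 * y (t + tau) j 0).
  by apply: eq_Rintegral => tau _; rewrite mul_tensI.
apply: (is_derive_window_integral (a := fun tau => f tau i 0)
  (a1 := fun tau => (M *m f tau) i 0) (h := fun t => y t j 0)) => //.
- by move=> tau taur; apply: (@has_derivative_on_entry _ _ _ _ f) (f_ode taur).
- apply: continuous_subspaceT.
  exact: (entrywise_continuousMl f_cont).
Qed.

Lemma is_derive_window_quad_form (A : 'M[R]_n) y (t : R) : entrywise_continuous y ->
  is_derive t (1 : R) (fun s => \int[mu]_(tau in `[- r, 0]) quad_form A (y (s + tau)))
    (quad_form A (y t) - quad_form A (y (t - r))).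
Proof.
move=> cy; have cA := quad_form_continuous (A := A) cy.
have -> : (fun s => \int[mu]_(tau in `[- r, 0]) quad_form A (y (s + tau))) =
    (fun s => \int[mu]_(tau in `[- r, 0]) (1 * quad_form A (y (s + tau)))).
  by apply/funext => s; apply: eq_Rintegral => tau _; rewrite mul1r.
have -> : quad_form A (y t) - quad_form A (y (t - r)) =
    1 * quad_form A (y t) - 1 * quad_form A (y (t - r))
    - \int[mu]_(tau in `[- r, 0]) (0 * quad_form A (y (t + tau))).
  under eq_Rintegral do rewrite mul0r.
  by rewrite Rintegral_cst// mul0r subr0 !mul1r.
apply: (is_derive_window_integral (a := fun=> 1) (a1 := fun=> 0)
  (h := fun t => quad_form A (y t))) => //.
  by move=> tau _; exact: has_derivative_on_cst.
by apply: continuous_subspaceT; exact: cst_continuous.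
Qed.

Lemma is_derive_weighted_window_quad_form (A : 'M[R]_n) y (t : R) :
  entrywise_continuous y ->
  is_derive t (1 : R)
    (fun s => \int[mu]_(tau in `[- r, 0]) ((tau + r) * quad_form A (y (s + tau))))
    (r * quad_form A (y t)
     - \int[mu]_(tau in `[- r, 0]) quad_form A (y (t + tau))).
Proof.
move=> cy; have cA := quad_form_continuous (A := A) cy.
have -> : r * quad_form A (y t)
      - \int[mu]_(tau in `[- r, 0]) quad_form A (y (t + tau)) =
    (0 + r) * quad_form A (y t) - (- r + r) * quad_form A (y (t - r))
    - \int[mu]_(tau in `[- r, 0]) (1 * quad_form A (y (t + tau))).
  under [X in _ = _ - X]eq_Rintegral do rewrite mul1r.
  by rewrite add0r addNr mul0r subr0.
apply: (is_derive_window_integral (a := fun tau => tau + r) (a1 := fun=> 1)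
  (h := fun t => quad_form A (y t))) => //.
  move=> tau _; apply: is_derive_has_derivative_on.
  rewrite -[X in is_derive _ _ _ X]addr0.
  exact: (is_deriveD (is_derive_id tau 1) (is_derive_cst r tau 1)).
by apply: continuous_subspaceT; exact: cst_continuous.
Qed.

Variables (Pa : 'M[R]_n) (Qa : 'M[R]_(n, d * n)).
Variables (Ra : 'M[R]_(d * n)) (Sa Ua : 'M[R]_n).
Hypotheses (Pa_sym : Pa^T = Pa) (Ra_sym : Ra^T = Ra).
Hypotheses (Sa_gt0 : posdef Sa) (Ua_gt0 : posdef Ua).
Let gram_mx := mx_integral (- r) 0 (fun tau => f tau *m (f tau)^T).
Hypothesis gram_unit : gram_mx \in unitmx.
Hypothesis lyap : lyapunov_lmi r f Pa Qa Ra Sa.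

(** The Lyapunov-Krasovskii functional of the variable [y = X^-1 x]. *)
Definition functional y (t : R) : R :=
  quad_form (sym2 Pa Qa Ra) (col_mx (y t) (weighted_window y t))
  + (\int[mu]_(tau in `[- r, 0]) quad_form Sa (y (t + tau))
     + \int[mu]_(tau in `[- r, 0]) ((tau + r) * quad_form Ua (y (t + tau)))).

Lemma eq_functional y z (s t : R) :
  (forall tau, - r <= tau <= 0 -> y (s + tau) = z (t + tau)) ->
  functional y s = functional z t.
Proof.
move=> yz; have yz0 : y s = z t.
  by have := yz 0; rewrite !addr0; apply; rewrite oppr_le0 ltW/=.
rewrite /functional /weighted_window yz0; congr (quad_form _ (col_mx _ _) + (_ + _)).
- by apply: eq_mx_integral => tau; rewrite in_itv/= => /yz->.
- by apply: eq_Rintegral => tau; rewrite inE/= in_itv/= => /yz->.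
- by apply: eq_Rintegral => tau; rewrite inE/= in_itv/= => /yz->.
Qed.

Lemma has_derivative_on_functional (D : set R) y (t : R) (dy : 'cV[R]_n) :
  entrywise_continuous y ->
  (forall i, has_derivative_on D (fun s => y s i 0 : R) t (dy i 0)) ->
  has_derivative_on D (functional y) t
    (2 * dot (col_mx dy (window_derivative r f M (y t) (y (t - r)) (weighted_window y t)))
       (sym2 Pa Qa Ra *m col_mx (y t) (weighted_window y t))
     + (quad_form Sa (y t) - quad_form Sa (y (t - r))
        + (r * quad_form Ua (y t)
           - \int[mu]_(tau in `[- r, 0]) quad_form Ua (y (t + tau))))).
Proof.
move=> cy dyt.
apply: has_derivative_onD; [|apply: has_derivative_onD].
- apply: has_derivative_on_quad_form => [|k].
    by rewrite /sym2 tr_block_mx Pa_sym Ra_sym trmxK.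
  case: (splitP k) => k' kE.
    have -> : k = lshift _ k' by apply: val_inj.
    rewrite col_mxEu; under eq_fun do rewrite col_mxEu.
    exact: dyt.
  have -> : k = rshift _ k' by apply: val_inj.
  rewrite col_mxEd; under eq_fun do rewrite col_mxEd.
  apply: is_derive_has_derivative_on; exact: is_derive_weighted_window.
- exact/is_derive_has_derivative_on/is_derive_window_quad_form.
- exact/is_derive_has_derivative_on/is_derive_weighted_window_quad_form.
Qed.

Lemma is_derive_continuous (g dg : R -> R) :
  (forall t, is_derive t (1 : R) g (dg t)) -> continuous g.
Proof.
by move=> gdg t; apply/differentiable_continuous/derivable1_diffP; have [] := gdg t.
Qed.

Lemma weighted_window_continuous y : entrywise_continuous y ->
  entrywise_continuous (weighted_window y).
Proof.
move=> cy i j; rewrite ord1.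
exact: is_derive_continuous (fun t => is_derive_weighted_window t i cy).
Qed.

Lemma functional_continuous y : entrywise_continuous y -> continuous (functional y).
Proof.
move=> cy t; apply: cvgD.
  apply: quad_form_continuous => k j; rewrite ord1.
  case: (splitP k) => k' kE.
    have -> : k = lshift _ k' by apply: val_inj.
    by under eq_fun do rewrite col_mxEu; exact: cy.
  have -> : k = rshift _ k' by apply: val_inj.
  by under eq_fun do rewrite col_mxEd; exact: weighted_window_continuous.
apply: cvgD.
  exact: is_derive_continuous (fun t => is_derive_window_quad_form Sa t cy) t.
exact: is_derive_continuous (fun t => is_derive_weighted_window_quad_form Ua t cy) t.
Qed.

Lemma integral_window_ge (S : 'M[R]_n) y (t : R) : posdef S ->
  entrywise_continuous y ->
  quad_form (sfF r f *t S) (weighted_window y t)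
  <= \int[mu]_(tau in `[- r, 0]) quad_form S (y (t + tau)).
Proof.
move=> dS cy; have cyt := entrywise_continuous_shift (c := t) cy.
exact: (integral_quad_form_ge f_cont gram_unit (possemidef_posdef dS) cyt).
Qed.

(** By Bessel's inequality the integral of the form of [Sa] contributes
    [sfF (x) Sa], which completes [Ra] to the block of the first inequality. *)
Lemma functional_ge y (t : R) : entrywise_continuous y ->
  quad_form (sym2 Pa Qa (Ra + sfF r f *t Sa)) (col_mx (y t) (weighted_window y t))
  <= functional y t.
Proof.
move=> cy; rewrite /functional !quad_form_sym2 quad_formD.
have := integral_window_ge t Sa_gt0 cy.
have : 0 <= \int[mu]_(tau in `[- r, 0]) ((tau + r) * quad_form Ua (y (t + tau))).
  apply: Rintegral_ge0 => tau; rewrite /= in_itv/= => /andP[rtau _].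
  rewrite mulr_ge0//; first by rewrite -lerBlDr sub0r.
  by have [_] := possemidef_posdef Ua_gt0.
lra.
Qed.

Lemma functional_coercive : exists2 c : R, 0 < c &
  forall y (t : R), entrywise_continuous y -> c * dot (y t) (y t) <= functional y t.
Proof.
have [c c0 hc] := posdef_coercive lyap.
exists c => // y t cy; apply: le_trans (functional_ge t cy).
apply: le_trans (hc _); rewrite ler_pM2l// dot_col lerDl; exact: dot_ge0.
Qed.

End functional.

(** * The Lyapunov functional on the space of histories *)

Section bounds.
Context {R : realType}.

Definition entries_le {k} (u : 'cV[R]_k) (a : R) := forall i, `|u i 0| <= a.

Lemma entries_le_norm k (u : 'cV[R]_k) : entries_le u `|u|.
Proof.
move=> i; rewrite [leRHS]mx_normrE.
exact: (le_bigmax_cond 0 (fun ij : 'I_k * 'I_1 => `|u ij.1 ij.2|) (j := (i, 0))).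
Qed.

Lemma norm_le_entries k (u : 'cV[R]_k) (a : R) : 0 <= a -> entries_le u a -> `|u| <= a.
Proof.
move=> a0 ua; rewrite [leLHS]mx_normrE; apply/bigmax_leP; split=> // -[i j] _.
by rewrite ord1; exact: ua.
Qed.

Lemma entries_leW k (u : 'cV[R]_k) (a b : R) : a <= b -> entries_le u a -> entries_le u b.
Proof. by move=> ab ua i; apply: le_trans (ua i) ab. Qed.

Lemma entries_le_col k l (u : 'cV[R]_k) (v : 'cV[R]_l) (a : R) :
  entries_le u a -> entries_le v a -> entries_le (col_mx u v) a.
Proof. by move=> ua va i; rewrite mxE; case: splitP => j _; [exact: ua|exact: va]. Qed.

Lemma entries_leD k (u v : 'cV[R]_k) (a b : R) :
  entries_le u a -> entries_le v b -> entries_le (u + v) (a + b).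
Proof.
by move=> ua vb i; rewrite mxE (le_trans (ler_normD _ _))// lerD ?ua ?vb.
Qed.

Lemma norm_dot_le k (u v : 'cV[R]_k) (a b : R) :
  entries_le u a -> entries_le v b -> `|dot u v| <= k%:R * (a * b).
Proof.
move=> ua vb; rewrite dotE (le_trans (ler_norm_sum _ _ _))//.
apply: (le_trans (y := \sum_(i < k) a * b)).
  by apply: ler_sum => i _; rewrite normrM ler_pM.
by rewrite sumr_const card_ord mulr_natl.
Qed.

Lemma entries_le_mulmx k l (A : 'M[R]_(k, l)) : exists2 c : R, 0 < c &
  forall v b, 0 <= b -> entries_le v b -> entries_le (A *m v) (c * b).
Proof.
exists (1 + \sum_i \sum_j `|A i j|) => [|v b b0 vb i].
  by rewrite ltr_pwDl// sumr_ge0// => i _; rewrite sumr_ge0.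
rewrite mxE (le_trans (ler_norm_sum _ _ _))//.
apply: (le_trans (y := (\sum_j `|A i j|) * b)).
  by rewrite mulr_suml; apply: ler_sum => j _; rewrite normrM ler_wpM2l.
rewrite ler_wpM2r// ler_wpDl// (bigD1 i)//= lerDl sumr_ge0// => j _.
by rewrite sumr_ge0.
Qed.

Lemma norm_dot_mulmx_le k l (A : 'M[R]_(k, l)) : exists2 c : R, 0 < c &
  forall u v a b, 0 <= a -> 0 <= b -> entries_le u a -> entries_le v b ->
    `|dot u (A *m v)| <= c * (a * b).
Proof.
have [c c0 hc] := entries_le_mulmx A.
exists (k.+1%:R * c) => [|u v a b a0 b0 ua vb]; first by rewrite mulr_gt0// ltr0n.
apply: le_trans (norm_dot_le ua (hc v b b0 vb)) _.
have -> : k%:R * (a * (c * b)) = k%:R * c * (a * b) by ring.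
apply: ler_wpM2r; first exact: mulr_ge0.
by apply: ler_wpM2r; [exact: ltW|rewrite ler_nat].
Qed.

End bounds.

Section window_bounds.
Context {R : realType} {n d : nat}.
Notation mu := (@lebesgue_measure R).
Variables (r : R) (f : R -> 'cV[R]_d).
Hypothesis r_gt0 : 0 < r.
Hypothesis f_cont : entrywise_continuous f.
Implicit Types y z : R -> 'cV[R]_n.

Lemma entries_le_continuous k (g : R -> 'cV[R]_k) (a b : R) : entrywise_continuous g ->
  exists2 B : R, 0 < B & forall t, a <= t <= b -> entries_le (g t) B.
Proof.
move=> cg.
have /choice[B hB] (i : 'I_k) : exists B : R, 0 < B /\
    forall t, a <= t <= b -> `|g t i 0| <= B.
  have [B B0 hB] := within_continuous_bounded
    (continuous_subspaceT (A := `[a, b]%classic) (cg i 0)).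
  by exists B.
exists (1 + \sum_i B i) => [|t tab i].
  by rewrite ltr_pwDl// sumr_ge0// => i _; have [/ltW] := hB i.
have [_ /(_ t tab) hi] := hB i; apply: le_trans hi _.
rewrite ler_wpDl// (bigD1 i)//= lerDl sumr_ge0// => j _.
by have [/ltW] := hB j.
Qed.

Definition window_le y (t a : R) : Prop :=
  forall tau, - r <= tau <= 0 -> entries_le (y (t + tau)) a.

Lemma weighted_window_le : exists2 c : R, 0 < c & forall y (t a : R),
  0 <= a -> entrywise_continuous y -> window_le y t a ->
  entries_le (weighted_window r f y t) (c * a).
Proof.
have [B B0 fB] := entries_le_continuous (- r) 0 f_cont.
exists (B * r) => [|y t a a0 cy ya k]; first by rewrite mulr_gt0.
case: (mxtens_indexP k) => i j; rewrite mxE.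
have -> : B * r * a = B * a * (0 - - r) by rewrite sub0r opprK mulrAC.
apply: Rintegral_le_bound.
- by rewrite oppr_le0 ltW.
- exact: entrywise_continuous_window.
- move=> tau taur; rewrite mul_tensI normrM ler_pM//; first exact: fB.
  exact: ya.
Qed.

Variables (Pa : 'M[R]_n) (Qa : 'M[R]_(n, d * n)).
Variables (Ra : 'M[R]_(d * n)) (Sa Ua : 'M[R]_n).

(** The polar form of [functional]; its boundedness gives both the upper bound
    and the differentiability of the functional. *)
Definition functional2 y z (t : R) : R :=
  dot (col_mx (y t) (weighted_window r f y t))
    (sym2 Pa Qa Ra *m col_mx (z t) (weighted_window r f z t))
  + (\int[mu]_(tau in `[- r, 0]) dot (y (t + tau)) (Sa *m z (t + tau))
     + \int[mu]_(tau in `[- r, 0])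
         ((tau + r) * dot (y (t + tau)) (Ua *m z (t + tau)))).

Lemma functional2_diag y (t : R) :
  functional2 y y t = functional r f Pa Qa Ra Sa Ua y t.
Proof.
rewrite /functional quad_formE; congr (_ + (_ + _)).
  by apply: eq_Rintegral => tau _; rewrite quad_formE.
by apply: eq_Rintegral => tau _; rewrite quad_formE.
Qed.

Lemma dot_window_continuous (A : 'M[R]_n) y z (t : R) : entrywise_continuous y ->
  entrywise_continuous z ->
  continuous (fun tau => dot (y (t + tau)) (A *m z (t + tau))).
Proof.
move=> cy cz; apply: dot_continuous; first exact: entrywise_continuous_shift.
exact/entrywise_continuousMl/entrywise_continuous_shift.
Qed.

Lemma weighted_dot_window_continuous (A : 'M[R]_n) y z (t : R) :
  entrywise_continuous y -> entrywise_continuous z ->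
  continuous (fun tau => (tau + r) * dot (y (t + tau)) (A *m z (t + tau))).
Proof.
move=> cy cz tau; apply: cvgM; last exact: dot_window_continuous.
by apply: cvgD; [exact: cvg_id|exact: cvg_cst].
Qed.

Lemma functional2_le : exists2 C : R, 0 < C & forall y z (t a b : R),
  0 <= a -> 0 <= b -> entrywise_continuous y -> entrywise_continuous z ->
  window_le y t a -> window_le z t b -> `|functional2 y z t| <= C * (a * b).
Proof.
have [c c0 hc] := weighted_window_le.
have [cP cP0 hP] := norm_dot_mulmx_le (sym2 Pa Qa Ra).
have [cS cS0 hS] := norm_dot_mulmx_le Sa.
have [cU cU0 hU] := norm_dot_mulmx_le Ua.
have r0 := ltW r_gt0.
exists (cP * ((1 + c) * (1 + c)) + (cS * r + r * cU * r));
  last move=> y z t a b a0 b0 cy cz ya zb.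
  by rewrite addr_gt0 ?addr_gt0 ?mulr_gt0 ?addr_gt0.
have r00 : - r <= (0 : R) <= 0 by rewrite oppr_le0 r0 lexx.
have colb x e : 0 <= e -> entrywise_continuous x -> window_le x t e ->
    entries_le (col_mx (x t) (weighted_window r f x t)) ((1 + c) * e).
  move=> e0 cx xe; apply: entries_le_col.
    have := xe 0 r00; rewrite addr0; apply: entries_leW.
    by rewrite ler_peMl// lerDl ltW.
  by apply: entries_leW (hc x t e e0 cx xe); rewrite ler_wpM2r// lerDr.
rewrite (le_trans (ler_normD _ _))// mulrDl lerD//.
  have c10 e : 0 <= e -> 0 <= (1 + c) * e by move=> e0; rewrite mulr_ge0// addr_ge0// ltW.
  apply: le_trans (hP _ _ _ _ (c10 _ a0) (c10 _ b0) (colb _ _ a0 cy ya)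
    (colb _ _ b0 cz zb)) _.
  by rewrite -mulrA ler_pM2l// mulrACA.
rewrite (le_trans (ler_normD _ _))// mulrDl lerD//.
- have -> : cS * r * (a * b) = cS * (a * b) * (0 - - r) by rewrite sub0r opprK mulrAC.
  apply: Rintegral_le_bound; first by rewrite oppr_le0.
    exact: dot_window_continuous.
  by move=> tau taur; apply: hS => //; [exact: ya|exact: zb].
- have -> : r * cU * r * (a * b) = r * (cU * (a * b)) * (0 - - r).
    by rewrite sub0r opprK; ring.
  apply: Rintegral_le_bound; first by rewrite oppr_le0.
    exact: weighted_dot_window_continuous.
  move=> tau taur; rewrite normrM ler_pM//.
    by move/andP: taur => [? ?]; rewrite ger0_norm; lra.
  by apply: hU => //; [exact: ya|exact: zb].
Qed.

Lemma weighted_windowP y z (t a : R) : entrywise_continuous y ->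
  entrywise_continuous z ->
  weighted_window r f (fun s => a *: y s + z s) t
  = a *: weighted_window r f y t + weighted_window r f z t.
Proof.
move=> cy cz.
have cFy := entrywise_continuous_window (t := t) f_cont cy.
have cFz := entrywise_continuous_window (t := t) f_cont cz.
rewrite -mul_scalar_mx -mx_integralMl// -mx_integralD//; last first.
  exact: entrywise_continuousMl.
apply: eq_mx_integral => tau _.
by rewrite mulmxDr -scalemxAr mul_scalar_mx.
Qed.

Lemma functional2Pl y1 y2 z (t a : R) : entrywise_continuous y1 ->
  entrywise_continuous y2 -> entrywise_continuous z ->
  functional2 (fun s => a *: y1 s + y2 s) z t
  = a * functional2 y1 z t + functional2 y2 z t.
Proof.
move=> c1 c2 cz; rewrite /functional2 weighted_windowP//.
rewrite -add_col_mx -scale_col_mx dotDl dotZl.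
have i1 := continuous_integrable (- r) 0
  (dot_window_continuous (A := Sa) (t := t) c1 cz).
have i2 := continuous_integrable (- r) 0
  (dot_window_continuous (A := Sa) (t := t) c2 cz).
have j1 := continuous_integrable (- r) 0
  (weighted_dot_window_continuous (A := Ua) (t := t) c1 cz).
have j2 := continuous_integrable (- r) 0
  (weighted_dot_window_continuous (A := Ua) (t := t) c2 cz).
have -> : \int[mu]_(tau in `[- r, 0])
      dot (a *: y1 (t + tau) + y2 (t + tau)) (Sa *m z (t + tau)) =
    a * (\int[mu]_(tau in `[- r, 0]) dot (y1 (t + tau)) (Sa *m z (t + tau)))
    + \int[mu]_(tau in `[- r, 0]) dot (y2 (t + tau)) (Sa *m z (t + tau)).
  rewrite -RintegralZl// -RintegralD//.
    by apply: eq_Rintegral => tau _; rewrite dotDl dotZl.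
  apply: (continuous_integrable (g := fun tau => a * _)) => tau.
  by apply: cvgM; [exact: cvg_cst|exact: dot_window_continuous].
have -> : \int[mu]_(tau in `[- r, 0])
      ((tau + r) * dot (a *: y1 (t + tau) + y2 (t + tau)) (Ua *m z (t + tau))) =
    a * (\int[mu]_(tau in `[- r, 0]) ((tau + r) * dot (y1 (t + tau)) (Ua *m z (t + tau))))
    + \int[mu]_(tau in `[- r, 0]) ((tau + r) * dot (y2 (t + tau)) (Ua *m z (t + tau))).
  rewrite -RintegralZl// -RintegralD//.
    by apply: eq_Rintegral => tau _; rewrite dotDl dotZl; ring.
  apply: (continuous_integrable (g := fun tau => a * _)) => tau.
  by apply: cvgM; [exact: cvg_cst|exact: weighted_dot_window_continuous].
ring.
Qed.

Hypotheses (Pa_sym : Pa^T = Pa) (Ra_sym : Ra^T = Ra).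
Hypotheses (Sa_sym : Sa^T = Sa) (Ua_sym : Ua^T = Ua).

Lemma functional2C y z (t : R) : functional2 y z t = functional2 z y t.
Proof.
rewrite /functional2 quad_formS; last first.
  by rewrite /sym2 tr_block_mx Pa_sym Ra_sym trmxK.
congr (_ + (_ + _)).
  by apply: eq_Rintegral => tau _; rewrite quad_formS.
by apply: eq_Rintegral => tau _; rewrite quad_formS.
Qed.

End window_bounds.

Section clamp.
Context {R : realType}.

Definition clamp (a b t : R) : R := Num.max a (Num.min t b).

Lemma clamp_in (a b t : R) : a <= b -> a <= clamp a b t <= b.
Proof. by move=> ab; rewrite /clamp le_max lexx ge_max ab ge_min lexx orbT. Qed.

Lemma clamp_id (a b t : R) : a <= t <= b -> clamp a b t = t.
Proof. by move=> /andP[at_ tb]; rewrite /clamp (min_idPl tb) (max_idPr at_). Qed.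

Lemma clamp_continuous (a b : R) : continuous (clamp a b).
Proof.
move=> t; apply: (@continuous_max _ _ (cst a) (fun t => Num.min t b) t).
  exact: cst_continuous.
by apply: (@continuous_min _ _ id (cst b) t); [exact: cvg_id|exact: cst_continuous].
Qed.

Lemma continuous_comp_within (T : topologicalType) (A : set R) (g : R -> T)
    (k : R -> R) :
  {within A, continuous g} -> continuous k -> (forall t, A (k t)) ->
  continuous (g \o k).
Proof.
move=> /subspace_continuousP cg ck Ak t W /(cg _ (Ak t)) gW.
have : nbhs t [set s | A (k s) -> W (g (k s))] := ck t _ gW.
suff sub : [set s | A (k s) -> W (g (k s))] `<=` (g \o k) @^-1` W by exact: filterS.
by move=> s; exact.
Qed.

End clamp.

Section history_functional.
Context {R : realType} {n d : nat}.
Variables (r : R).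
Hypothesis r_gt0 : 0 < r.

Let clamp_mem (t : R) : clamp (- r) 0 t \in `[- r, 0]%classic.
Proof. by rewrite inE/= in_itv/= clamp_in// oppr_le0 ltW. Qed.

Definition clamp_sub (t : R) : `[- r, 0]%classic :=
  exist (fun x => x \in `[- r, 0]%classic) (clamp (- r) 0 t) (clamp_mem t).

Lemma clamp_sub_continuous : continuous clamp_sub.
Proof. by apply: continuous_comp_initial; exact: clamp_continuous. Qed.

(** Extending histories to the line by their values at the end points makes
    them subject to the lemmas on continuous functions of a real variable. *)
Definition extension (phi : history r n) (t : R) : 'cV[R]_n := phi (clamp_sub t).

Lemma extension_continuous phi : continuous (extension phi).
Proof.
move=> t; apply: (@continuous_comp _ _ _ clamp_sub (history_fun phi)).
  exact: clamp_sub_continuous.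
have /asboolP cphi := valP phi.
exact: cphi.
Qed.

Lemma extension_entrywise_continuous phi : entrywise_continuous (extension phi).
Proof. exact/continuous_entrywise/extension_continuous. Qed.

Lemma extensionP a phi psi t :
  extension (a *: phi + psi) t = a *: extension phi t + extension psi t.
Proof. by []. Qed.

Lemma extension_le phi (t : R) : entries_le (extension phi t) `|phi|.
Proof.
apply: entries_leW (entries_le_norm _).
exact: (history_norm_ubound phi (clamp_sub t)).
Qed.

Variables (f : R -> 'cV[R]_d).
Hypothesis f_cont : entrywise_continuous f.
Variables (Pa Z : 'M[R]_n) (Qa : 'M[R]_(n, d * n)).
Variables (Ra : 'M[R]_(d * n)) (Sa Ua : 'M[R]_n).
Hypotheses (Pa_sym : Pa^T = Pa) (Ra_sym : Ra^T = Ra).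
Hypotheses (Sa_sym : Sa^T = Sa) (Ua_sym : Ua^T = Ua).

Definition scaled_extension phi (t : R) := Z *m extension phi t.

Lemma scaled_extension_continuous phi :
  entrywise_continuous (scaled_extension phi).
Proof. exact/entrywise_continuousMl/extension_entrywise_continuous. Qed.

Definition history_functional (phi : history r n) : R :=
  functional r f Pa Qa Ra Sa Ua (scaled_extension phi) 0.

Lemma history_functional_differentiable phi : differentiable history_functional phi.
Proof.
pose B (phi psi : history r n) : R :=
  functional2 r f Pa Qa Ra Sa Ua (scaled_extension phi) (scaled_extension psi) 0.
have -> : history_functional = (fun phi => B phi phi).
  by apply/funext => psi; rewrite /B functional2_diag.
have sE a (x y : history r n) : scaled_extension (a *: x + y) =
    (fun s => a *: scaled_extension x s + scaled_extension y s).
  by apply/funext => s; rewrite /scaled_extension extensionP mulmxDr -scalemxAr.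
have BDl a x y z : B (a *: x + y) z = a * B x z + B y z.
  by rewrite /B sE functional2Pl//; exact: scaled_extension_continuous.
have BC x y : B x y = B y x by exact: functional2C.
have BDr a x y z : B z (a *: x + y) = a * B z x + B z y.
  by rewrite BC BDl !(BC z).
have [c c0 hc] := entries_le_mulmx Z.
have [C C0 hC] := functional2_le r_gt0 f_cont Pa Qa Ra Sa Ua.
apply: (@bounded_quadratic_differentiable _ _ B (C * c * c)) => // x y.
have sle (u : history r n) : window_le r (scaled_extension u) 0 (c * `|u|).
  by move=> tau _; apply: hc => //; exact: extension_le.
have -> : C * c * c * `|x| * `|y| = C * ((c * `|x|) * (c * `|y|)) by ring.
by apply: hC => //; rewrite ?mulr_ge0 ?(ltW c0)//; exact: scaled_extension_continuous.
Qed.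

End history_functional.

(** * Closed-loop trajectories *)

Section clamped_weights.
Context {R : realType} {d : nat}.
Variables (r : R) (f : R -> 'cV[R]_d) (M : 'M[R]_d).
Hypothesis r_gt0 : 0 < r.
Hypothesis f_ode : forall tau : R, tau \in `[- r, 0] ->
  has_derivative_on `[- r, 0] f tau (M *m f tau).

(** The differential equation controls [f] on [- r, 0] only; extended from there
    by constants, it is continuous on the line. *)
Definition clamped : R -> 'cV[R]_d := f \o clamp (- r) 0.

Lemma clamped_id tau : - r <= tau <= 0 -> clamped tau = f tau.
Proof. by move=> taur; rewrite /clamped /= clamp_id. Qed.

Lemma clamped_continuous : entrywise_continuous clamped.
Proof.
move=> i j; rewrite ord1.
apply: (@continuous_comp_within _ _ `[- r, 0]%classic (fun t => f t i 0)
  (clamp (- r) 0)).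
- apply/subspace_continuousP => tau taur.
  have fi : has_derivative_on `[- r, 0] (fun t => f t i 0 : R) tau ((M *m f tau) i 0).
    by apply: has_derivative_on_entry; exact: f_ode.
  exact: has_derivative_on_cvg fi.
- exact: clamp_continuous.
- by move=> t; rewrite /= in_itv/= clamp_in// oppr_le0 ltW.
Qed.

Lemma clamped_ode tau : tau \in `[- r, 0] ->
  has_derivative_on `[- r, 0] clamped tau (M *m clamped tau).
Proof.
move=> taur; have := f_ode taur.
have taur' : - r <= tau <= 0 by move: taur; rewrite in_itv.
rewrite clamped_id//; apply: cvg_trans; apply: near_eq_cvg.
apply/near_within_dnbhs; exists 1 => // s _ _; rewrite /= in_itv/= => sr.
by rewrite !clamped_id.
Qed.

Lemma gram_clamped : gram r clamped = gram r f.
Proof. by apply: eq_mx_integral => tau; rewrite in_itv/= => taur; rewrite clamped_id. Qed.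

End clamped_weights.

Lemma addr_interleave (W : zmodType) (a b c a' b' c' : W) :
  a + b + c + a' + b' + c' = (a + a') + (b + b') + (c + c').
Proof. by rewrite (addrACA a a') [RHS]addrACA !addrA. Qed.

Lemma subr_le_trans (R : realType) (r a b : R) : 0 < r -> a <= b -> a - r <= b.
Proof. by move=> r0 ab; lra. Qed.

Lemma nbhs_closed_ray (R : realType) (a u : R) : a < u -> nbhs u `[a, +oo[%classic.
Proof.
by move=> au; apply: filterS (lt_nbhsr au) => v; rewrite /= in_itv/= andbT; exact: ltW.
Qed.

Lemma norm_le_of_sqr (R : realType) (a b : R) : 0 <= b -> a ^+ 2 <= b ^+ 2 -> `|a| <= b.
Proof. by move=> b0 ab; rewrite -ler_sqr ?nnegrE// real_normK ?num_real. Qed.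

Lemma sqr_le_of_le_norm (R : realType) (a b : R) : 0 <= a -> a <= `|b| -> a ^+ 2 <= b ^+ 2.
Proof. by move=> a0 ab; rewrite -[leRHS]real_normK ?num_real// lerXn2r ?nnegrE. Qed.

Section closed_loop.
Context {R : realType} {n m p q d : nat}.
Notation mu := (@lebesgue_measure R).
Variables (r t0 : R) (f : R -> 'cV[R]_d) (M : 'M[R]_d).
Hypothesis r_gt0 : 0 < r.
Hypothesis f_ode : forall tau : R, tau \in `[- r, 0] ->
  has_derivative_on `[- r, 0] f tau (M *m f tau).
Hypothesis f_gram : posdef (gram r f).
Variables (P : plant R n m p q d) (s : supply_rate R m q).
Hypotheses (J1_unit : J1 s \in unitmx) (J1_inv_lt0 : negdef (invmx (J1 s))).
Variable alpha : 'I_(2 + d) -> R.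
Variables (Pa X : 'M[R]_n) (V : 'M[R]_(p, n)) (Qa : 'M[R]_(n, d * n)).
Variables (Ra : 'M[R]_(d * n)) (Sa Ua : 'M[R]_n).
Hypotheses (Pa_sym : Pa^T = Pa) (X_unit : X \in unitmx) (Ra_sym : Ra^T = Ra).
Hypotheses (Sa_sym : Sa^T = Sa) (Ua_sym : Ua^T = Ua).
Hypothesis PQRS_gt0 : lyapunov_lmi r f Pa Qa Ra Sa.
Hypotheses (Sa_gt0 : posdef Sa) (Ua_gt0 : posdef Ua).
Hypothesis Theta_lt0 : negdef (Theta r f M P s alpha Pa X V Qa Ra Sa Ua).

Let K := V *m invmx X.
Let fc := clamped r f.
Let fc_cont : entrywise_continuous fc := clamped_continuous r_gt0 f_ode.
Let fc_ode : forall tau : R, tau \in `[- r, 0] ->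
  has_derivative_on `[- r, 0] fc tau (M *m fc tau) := clamped_ode f_ode.

Let r_ge0 : - r <= (0 : R). Proof. by rewrite oppr_le0 ltW. Qed.

Let gram_unit : mx_integral (- r) 0 (fun tau => fc tau *m (fc tau)^T) \in unitmx.
Proof. by rewrite -/(gram r fc) gram_clamped posdef_unitmx. Qed.

Let sfF_clamped : sfF r fc = sfF r f. Proof. by rewrite /sfF gram_clamped. Qed.

Let lyap : lyapunov_lmi r fc Pa Qa Ra Sa.
Proof. by rewrite /lyapunov_lmi sfF_clamped. Qed.

Let Theta_clamped : Theta r fc M P s alpha Pa X V Qa Ra Sa Ua =
  Theta r f M P s alpha Pa X V Qa Ra Sa Ua.
Proof.
rewrite /Theta /Phi /F_blocks sfF_clamped /fc !clamped_id// ?r_ge0 ?lexx//.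
Qed.

Let W := functional r fc Pa Qa Ra Sa Ua.

Section trajectory.
Variables (phi : history r n) (w : R -> 'cV[R]_q) (x : R -> 'cV[R]_n).
Hypothesis x_traj : cls_trajectory f P K t0 phi w x.

(** Before [t0 - r] the value of [x] is arbitrary, and is replaced by a constant
    to obtain a function that is continuous on the line. *)
Definition prolonged (t : R) : 'cV[R]_n := x (Num.max (t0 - r) t).

(** The unknowns of the inequalities are congruent, through [X], to the matrices
    of a functional of [x]; in the variable [X^-1 x] the congruence disappears,
    and the unknowns themselves define the functional. *)
Definition scaled (t : R) : 'cV[R]_n := invmx X *m prolonged t.

Lemma prolonged_id (t : R) : t0 - r <= t -> prolonged t = x t.
Proof. by move=> tr; rewrite /prolonged (max_idPr tr). Qed.

Lemma prolonged_continuous : continuous prolonged.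
Proof.
apply: (continuous_comp_within (traj_continuous x_traj)) => t.
  apply: (@continuous_max _ _ (cst (t0 - r)) id t); first exact: cst_continuous.
  exact: cvg_id.
by rewrite /= in_itv/= andbT le_max lexx.
Qed.

Lemma scaled_continuous : entrywise_continuous scaled.
Proof. exact/entrywise_continuousMl/continuous_entrywise/prolonged_continuous. Qed.

Lemma mul_scaled (t : R) : t0 - r <= t -> X *m scaled t = x t.
Proof. by move=> tr; rewrite /scaled (mulKVmx X_unit) prolonged_id. Qed.

Lemma feedback_scaled (t : R) : t0 - r <= t -> feedback K x t = V *m scaled t.
Proof. by move=> tr; rewrite /feedback /K -mulmxA /scaled prolonged_id. Qed.

Let in_window (t tau : R) : t0 <= t -> tau \in `[- r, 0] -> t0 - r <= t + tau.
Proof. by rewrite in_itv/= => tt0 /andP[rtau _]; rewrite lerD. Qed.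

Lemma state_integral k (A : 'M[R]_(k, d * n)) (t : R) : t0 <= t ->
  mx_integral (- r) 0 (fun tau => A *m tensI (f tau) n *m x (t + tau)) =
  A *m ((1%:M : 'M[R]_d) *t X) *m weighted_window r fc scaled t.
Proof.
move=> tt0; rewrite -mx_integralMl; last first.
  exact: (entrywise_continuous_window (t := t) fc_cont scaled_continuous).
apply: eq_mx_integral => tau taur.
rewrite -(mul_scaled (in_window tt0 taur)) /fc clamped_id; last first.
  by rewrite in_itv in taur.
by rewrite -!mulmxA; congr (A *m _); rewrite !mulmxA tens_mul_tensI mul1mx.
Qed.

Lemma input_integral k (A : 'M[R]_(k, d * p)) (t : R) : t0 <= t ->
  mx_integral (- r) 0 
    (fun tau => A *m tensI (f tau) p *m feedback K x (t + tau)) =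
  A *m ((1%:M : 'M[R]_d) *t V) *m weighted_window r fc scaled t.
Proof.
move=> tt0; rewrite -mx_integralMl; last first.
  exact: (entrywise_continuous_window (t := t) fc_cont scaled_continuous).
apply: eq_mx_integral => tau taur.
rewrite (feedback_scaled (in_window tt0 taur)) /fc clamped_id; last first.
  by rewrite in_itv in taur.
by rewrite -!mulmxA; congr (A *m _); rewrite !mulmxA tens_mul_tensI mul1mx.
Qed.

Lemma cls_rhs_scaled (t : R) : t0 <= t -> cls_rhs r f P K x w t =
  scaled_rhs P X V (scaled t) (scaled (t - r)) (weighted_window r fc scaled t) (w t).
Proof.
move=> tt0; rewrite /cls_rhs /state_rhs /scaled_rhs.
have tr := subr_le_trans r_gt0 tt0.
have trr : t0 - r <= t - r by rewrite lerD2r.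
rewrite (state_integral (A3 P) tt0) (input_integral (B3 P) tt0).
rewrite (feedback_scaled tr) (feedback_scaled trr) -(mul_scaled tr) -(mul_scaled trr).
by rewrite !mulmxDl !mulmxA; congr (_ + _); rewrite addr_interleave.
Qed.

Lemma cls_output_scaled (t : R) : t0 <= t -> cls_output r f P K x w t =
  scaled_output P X V (scaled t) (scaled (t - r)) (weighted_window r fc scaled t) (w t).
Proof.
move=> tt0; rewrite /cls_output /output /scaled_output.
have tr := subr_le_trans r_gt0 tt0.
have trr : t0 - r <= t - r by rewrite lerD2r.
rewrite (state_integral (C3 P) tt0) (input_integral (B6 P) tt0).
rewrite (feedback_scaled tr) (feedback_scaled trr) -(mul_scaled tr) -(mul_scaled trr).
by rewrite !mulmxDl !mulmxA; congr (_ + _); rewrite addr_interleave.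
Qed.

Let H := history_functional r_gt0 fc Pa (invmx X) Qa Ra Sa Ua.

Lemma segment_of_prolonged (t : R) (theta : `[- r, 0]%classic) : t0 <= t ->
  segment_of r x t theta = prolonged (t + set_val theta).
Proof.
move=> tt0; rewrite /segment_of.
have theta_in (th : `[- r, 0]%classic) : set_val th \in `[- r, 0].
  exact: (set_valP th).
have xE : (fun th : `[- r, 0]%classic => x (t + set_val th)) =
    (fun th : `[- r, 0]%classic => prolonged (t + set_val th)).
  by apply/funext => th; rewrite (prolonged_id (in_window tt0 (theta_in th))).
rewrite xE.
have cp : continuous (fun th : `[- r, 0]%classic => prolonged (t + set_val th)).
  move=> th; apply: (@continuous_comp _ _ _ (fun th => t + set_val th) prolonged).
    apply: (@continuous_comp _ _ _ set_val (+%R t)).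
      exact: initial_continuous.
    by apply: cvgD; [exact: cvg_cst|exact: cvg_id].
  exact: prolonged_continuous.
have pE : `[< continuous (fun th : `[- r, 0]%classic => prolonged (t + set_val th)) >].
  exact/asboolP.
exact: (congr1 (fun g => g theta) (insubdK (0 : history r n) pE)).
Qed.

Lemma history_functional_segment (t : R) : t0 <= t ->
  H (segment_of r x t) = W scaled t.
Proof.
move=> tt0; rewrite /H /history_functional /W.
apply: (eq_functional _ r_gt0) => tau taur.
rewrite add0r /scaled_extension /extension (segment_of_prolonged _ tt0).
have -> : set_val (clamp_sub r_gt0 tau) = tau by exact: clamp_id.
by [].
Qed.

Let D : set R := `[t0, +oo[%classic.

(** The derivative of the functional contains minus the integral of the form of
    [Ua]; bounded by Bessel's inequality, it gives way to the term
    [- (sfF (x) Ua)] of [Theta], and the rest is [quad_form_Theta]. *)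
Lemma functional_dissipation (eps t : R) :
  (forall z, quad_form (Theta r f M P s alpha Pa X V Qa Ra Sa Ua) z
     <= - (eps * dot z z)) -> 0 <= eps -> t0 <= t ->
  (forall i, has_derivative_on D (fun u => x u i 0 : R) t (cls_rhs r f P K x w t i 0)) ->
  exists2 dv, has_derivative_on D (W scaled) t dv &
    dv <= supply s (cls_output r f P K x w t) (w t) - eps * dot (scaled t) (scaled t).
Proof.
move=> Th_le eps0 tt0 dx; set e := cls_rhs r f P K x w t.
have dscaled i : has_derivative_on D (fun u => scaled u i 0 : R) t ((invmx X *m e) i 0).
  have := @has_derivative_on_mulmx R n n D (invmx X) x t e dx i.
  apply: eq_has_derivative_on; last by rewrite /D/= in_itv/= andbT.
  move=> u; rewrite /D inE/= in_itv/= andbT => ut0.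
  by rewrite /scaled (prolonged_id (subr_le_trans r_gt0 ut0)).
exists (2 * dot (col_mx (invmx X *m e)
    (window_derivative r fc M (scaled t) (scaled (t - r)) (weighted_window r fc scaled t)))
  (sym2 Pa Qa Ra *m col_mx (scaled t) (weighted_window r fc scaled t))
  + (quad_form Sa (scaled t) - quad_form Sa (scaled (t - r))
     + (r * quad_form Ua (scaled t)
        - \int[mu]_(tau in `[- r, 0]) quad_form Ua (scaled (t + tau))))).
  exact: (has_derivative_on_functional r_gt0 fc_cont fc_ode Pa_sym Ra_sym
    scaled_continuous dscaled).
have Xe : X *m (invmx X *m e) = scaled_rhs P X V (scaled t) (scaled (t - r))
    (weighted_window r fc scaled t) (w t).
  by rewrite (mulKVmx X_unit) /e cls_rhs_scaled.
have bessel := integral_window_ge fc_cont gram_unit t Ua_gt0 scaled_continuous.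
have := Th_le (trajectory_vector P s X V (invmx X *m e) (scaled t) (scaled (t - r))
    (weighted_window r fc scaled t) (w t)).
rewrite -Theta_clamped (quad_form_Theta _ _ _ _ _ _ _ _ Ra_sym J1_unit Xe).
rewrite (cls_output_scaled tt0).
set zz := trajectory_vector _ _ _ _ _ _ _ _ _.
have zz_ge : dot (scaled t) (scaled t) <= dot zz zz.
  rewrite /zz /trajectory_vector !dot_col.
  rewrite addrA addrA addrAC [X in X + _ + _]addrC -!addrA lerDl.
  by rewrite !addr_ge0 ?dot_ge0.
have := ler_wpM2l eps0 zz_ge.
move: bessel; move: (dot zz zz) => dzz.
lra.
Qed.

End trajectory.
Lemma Theta_margin : exists2 eps : R, 0 < eps & forall z,
  quad_form (Theta r f M P s alpha Pa X V Qa Ra Sa Ua) z <= - (eps * dot z z).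
Proof.
have [eps eps0 h] := posdef_coercive Theta_lt0.
exists eps; first exact: eps0.
by move=> z; rewrite lerNr -quad_formN; exact: h.
Qed.

Let functional_lower : exists2 c : R, 0 < c &
  forall y (t : R), entrywise_continuous y -> c * dot (y t) (y t) <= W y t :=
  functional_coercive fc_cont Sa_gt0 Ua_gt0 gram_unit lyap.

Theorem closed_loop_dissipative : dissipative r f P K t0 s.
Proof.
have [eps eps0 Th_le] := Theta_margin.
have [c c0 W_ge] := functional_lower.
exists (history_functional r_gt0 fc Pa (invmx X) Qa Ra Sa Ua); split.
- move=> psi; exact: (@history_functional_differentiable R n d r r_gt0 fc fc_cont
    Pa (invmx X) Qa Ra Sa Ua Pa_sym Ra_sym Sa_sym Ua_sym psi).
- move=> psi; set y := scaled_extension r_gt0 (invmx X) psi.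
  have cy : entrywise_continuous y.
    exact: (@scaled_extension_continuous R n r r_gt0 (invmx X) psi).
  apply: le_trans (W_ge y 0 cy).
  by apply: mulr_ge0; [exact: ltW|exact: dot_ge0].
- move=> phi w x _ x_traj t tt0 xt.
  have xti i : has_derivative_on `[t0, +oo[ (fun u => x u i 0 : R) t
      (cls_rhs r f P K x w t i 0).
    by apply: has_derivative_on_entry; exact: xt.
  have [dv Wdv dv_le] := functional_dissipation x_traj Th_le (ltW eps0) tt0 xti.
  exists dv; split.
    apply: eq_has_derivative_on Wdv; last by rewrite /= in_itv/= tt0.
    move=> u; rewrite inE/= in_itv/= andbT => ut0.
    by rewrite -(history_functional_segment x_traj ut0).
  have := mulr_ge0 (ltW eps0) (dot_ge0 (scaled x t)).
  lra.
Qed.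

Section unforced.
Variables (phi : history r n) (x : R -> 'cV[R]_n).
Hypothesis x_traj : cls_trajectory f P K t0 phi (fun=> 0) x.

Let Y := scaled x.
Let Y_cont : entrywise_continuous Y := scaled_continuous x_traj.
Let rhs (t : R) := scaled_rhs P X V (Y t) (Y (t - r)) (weighted_window r fc Y t) 0.

Lemma unforced_rhs_continuous : entrywise_continuous rhs.
Proof.
have cr : entrywise_continuous (fun t => Y (t - r)).
  move=> i j t; apply: (@continuous_comp _ _ _ (fun t => t - r) (fun t => Y t i j)).
    by apply: cvgB; [exact: cvg_id|exact: cvg_cst].
  exact: Y_cont.
have cw := weighted_window_continuous r_gt0 fc_cont fc_ode Y_cont.
apply: entrywise_continuousD; last first.
  by apply: entrywise_continuousMl; exact: entrywise_continuous_cst.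
apply: entrywise_continuousD; last exact: entrywise_continuousMl cw.
apply: entrywise_continuousD; first exact: entrywise_continuousMl Y_cont.
exact: entrywise_continuousMl cr.
Qed.

(** Without disturbance the right-hand side is continuous, so that the integral
    equation makes the trajectory classical after [t0]. *)
Lemma unforced_is_derive (t : R) i : t0 < t ->
  is_derive t (1 : R) (fun u => x u i 0 : R) (rhs t i 0).
Proof.
move=> tt0; have cri : continuous (fun u => rhs u i 0 : R).
  exact: unforced_rhs_continuous.
have xE (u : R) : t0 <= u ->
    x u i 0 = x t0 i 0 + \int[mu]_(v in `[t0, u]) rhs v i 0.
  move=> ut0; rewrite [in LHS](traj_integral x_traj ut0) !mxE; congr (_ + _).
  apply: eq_Rintegral => v; rewrite inE/= in_itv/= => /andP[vt0 _].
  by rewrite (cls_rhs_scaled x_traj vt0).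
apply: (@near_eq_is_derive _ _ _
  (fun u => x t0 i 0 + \int[mu]_(v in `[t0, u]) rhs v i 0)).
  near=> u; have ut0 : t0 <= u by apply: ltW; near: u; exact: lt_nbhsr.
  exact: esym (xE u ut0).
rewrite -[X in is_derive _ _ _ X]add0r; apply: is_deriveD.
exact: is_derive_primitive cri tt0.
Unshelve. all: by end_near. Qed.

Lemma supply_unforced_le0 (z : 'cV[R]_m) : supply s z 0 <= 0.
Proof.
rewrite /supply quad_form_sym2 !quad_formE !mulmx0 !dot0r mulr0 !addr0.
rewrite -!mulmxA dot_trmx dotC -quad_formE.
by have [_ /(_ (Jt s *m z))] := possemidef_posdef J1_inv_lt0; rewrite quad_formN oppr_ge0.
Qed.

(** Integrated form of the dissipation inequality. The supply rate is
    nonpositive when [w = 0], because the inverse of [J1] is negative. *)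
Lemma unforced_functional_decrease (eps a b c : R) :
  (forall z, quad_form (Theta r f M P s alpha Pa X V Qa Ra Sa Ua) z
     <= - (eps * dot z z)) -> 0 <= eps -> t0 <= a -> a <= b ->
  (forall u, a <= u <= b -> c <= dot (Y u) (Y u)) ->
  W Y b <= W Y a - eps * c * (b - a).
Proof.
move=> Th_le eps0 ta; rewrite le_eqVlt => /predU1P[<- _|ab c_le].
  by rewrite subrr mulr0 subr0.
have der (u : R) : u \in `]a, b[ -> exists2 dv, is_derive u (1 : R) (W Y) dv &
    dv <= - (eps * c).
  rewrite in_itv/= => /andP[au ub].
  have tu : t0 < u by exact: le_lt_trans ta au.
  have xti i : has_derivative_on `[t0, +oo[ (fun v => x v i 0 : R) u
      (cls_rhs r f P K x (fun=> 0) u i 0).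
    rewrite (cls_rhs_scaled x_traj (ltW tu)).
    apply: is_derive_has_derivative_on; exact: unforced_is_derive.
  have [dv Wdv dv_le] := functional_dissipation x_traj Th_le eps0 (ltW tu) xti.
  exists dv.
    apply: has_derivative_on_is_derive Wdv.
    exact: nbhs_closed_ray.
  apply: (le_trans dv_le).
  have := supply_unforced_le0 (cls_output r f P K x (fun=> 0) u).
  have uab : a <= u <= b by rewrite !ltW.
  have := ler_wpM2l eps0 (c_le u uab).
  rewrite -/Y; lra.
have cW : {within `[a, b], continuous (W Y)}.
  apply: continuous_subspaceT.
  exact: (functional_continuous r_gt0 fc_cont fc_ode Y_cont).
have dW (u : R) : u \in `]a, b[ -> is_derive u (1 : R) (W Y) ('D_1 (W Y) u).
  by move=> /der[dv [h <-] _]; exact: DeriveDef.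
have [u uab E] := MVT ab dW cW.
have [dv [_ dvE] dv_le] := der u uab.
have : 'D_1 (W Y) u * (b - a) <= - (eps * c) * (b - a).
  rewrite dvE; apply: ler_wpM2r; last exact: dv_le.
  by rewrite subr_ge0; exact: ltW ab.
rewrite -E; move: (W Y b) (W Y a) => wb wa; lra.
Qed.

Lemma initial_window_le (c : R) :
  (forall v b, 0 <= b -> entries_le v b -> entries_le (invmx X *m v) (c * b)) ->
  window_le r Y t0 (c * `|phi|).
Proof.
move=> hc tau taur; rewrite /Y /scaled; apply: hc; first exact: normr_ge0.
have tauin : tau \in `[- r, 0]%classic by rewrite inE/= in_itv/=.
have tau' : t0 - r <= t0 + tau by rewrite lerD2l; case/andP: taur.
rewrite (prolonged_id x tau').
have := traj_initial x_traj (exist (fun v => v \in `[- r, 0]%classic) tau tauin).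
move=> ->; apply: entries_leW (entries_le_norm _).
exact: (history_norm_ubound phi (exist (fun v => v \in `[- r, 0]%classic) tau tauin)).
Qed.

Lemma unforced_lipschitz (a b L : R) i : t0 <= a -> a <= b ->
  (forall u, a <= u <= b -> entries_le (rhs u) L) ->
  `|x b i 0 - x a i 0| <= L * (b - a).
Proof.
move=> ta; rewrite le_eqVlt => /predU1P[<- _|ab rhs_le].
  by rewrite !subrr mulr0 normr0.
have cx : {within `[a, b], continuous (fun u => x u i 0 : R)}.
  have sub : `[a, b] `<=` `[t0 - r, +oo[.
    move=> u; rewrite /= !in_itv/= andbT => /andP[au _].
    exact: subr_le_trans r_gt0 (le_trans ta au).
  have cx := continuous_subspaceW sub (traj_continuous x_traj).
  by move=> u; exact: (cvg_comp _ _ (cx u) (@coord_continuous _ _ _ i 0 (x u))).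
have dx (u : R) : u \in `]a, b[ -> is_derive u (1 : R) (fun u => x u i 0 : R) (rhs u i 0).
  by rewrite in_itv/= => /andP[au _]; apply: unforced_is_derive; exact: le_lt_trans ta au.
have [u] := MVT ab dx cx; rewrite in_itv/= => /andP[au ub] ->.
have ba : 0 < b - a by rewrite subr_gt0.
rewrite normrM (gtr0_norm ba); apply: ler_wpM2r; first exact: ltW ba.
by apply: rhs_le; rewrite !ltW.
Qed.

End unforced.

(** The functional decreases from its initial value, which is at most quadratic
    in the norm of the history, and it dominates the square of the state. *)
Lemma scaled_bound : exists2 kappa : R, 0 < kappa & forall (phi : history r n) x,
  cls_trajectory f P K t0 phi (fun=> 0) x -> forall t : R, t0 - r <= t ->
  entries_le (scaled x t) (kappa * `|phi|).
Proof.
have [eps eps0 Th_le] := Theta_margin.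
have [c c0 W_ge] := functional_lower.
have [C C0 W_le] := functional2_le r_gt0 fc_cont Pa Qa Ra Sa Ua.
have [z z0 hz] := entries_le_mulmx (invmx X).
pose A := C * (z * z) / c.
have A0 : 0 <= A.
  apply: divr_ge0; last exact: ltW.
  by apply: mulr_ge0; [exact: ltW|apply: mulr_ge0; exact: ltW].
(* the square of 1 + A is at least A, which saves a square root; z takes care of
   the times before t0 *)
exists (1 + A + z) => [|phi x x_traj t tr].
  by apply: ltr_wpDl; [apply: addr_ge0; [exact: ler01|exact: A0]|exact: z0].
have p0 : 0 <= `|phi| by exact: normr_ge0.
have win := initial_window_le x_traj hz.
have [tt0|tt0] := leP t0 t; last first.
  have tau_in : - r <= t - t0 <= 0.
    by rewrite subr_le0 (ltW tt0) andbT lerBrDl.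
  have := win _ tau_in; rewrite addrC subrK; apply: entries_leW.
  apply: ler_wpM2r; first exact: p0.
  by rewrite lerDr; apply: addr_ge0; [exact: ler01|exact: A0].
have cY := scaled_continuous x_traj.
have zp0 : 0 <= z * `|phi| by apply: mulr_ge0; [exact: ltW|exact: p0].
have dec := @unforced_functional_decrease _ _ x_traj eps t0 t 0 Th_le (ltW eps0)
  (lexx t0) tt0 (fun u _ => dot_ge0 _).
have up := W_le (scaled x) (scaled x) t0 _ _ zp0 zp0 cY cY win win.
rewrite functional2_diag in up.
have low := W_ge (scaled x) t cY.
have key : dot (scaled x t) (scaled x t) <= A * (`|phi| * `|phi|).
  rewrite -(ler_pM2l c0); apply: (le_trans low).
  have -> : c * (A * (`|phi| * `|phi|)) = C * (z * `|phi| * (z * `|phi|)).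
    by rewrite /A; field; rewrite gt_eqF.
  apply: (le_trans _ (le_trans (ler_norm _) up)).
  move: dec; rewrite mulr0 mul0r subr0 => W_dec; exact: W_dec.
move=> i; apply: norm_le_of_sqr.
  apply: mulr_ge0; last exact: p0.
  by apply: addr_ge0; [apply: addr_ge0; [exact: ler01|exact: A0]|exact: ltW].
apply: (le_trans (coord_le_dot _ i)); apply: (le_trans key).
rewrite -expr2 exprMn; apply: ler_wpM2r; first exact: sqr_ge0.
by move: A0 z0; clearbody A; nra.
Qed.

Theorem closed_loop_stable : lyapunov_stable r f P K t0.
Proof.
have [k k0 hk] := scaled_bound; have [c c0 hc] := entries_le_mulmx X.
have ck0 : 0 < c * k by exact: mulr_gt0.
move=> e e0; exists (e / (c * k)); first exact: divr_gt0.
move=> phi x x_traj phi_lt t tt0.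
have tr := subr_le_trans r_gt0 tt0.
have kp0 : 0 <= k * `|phi| by apply: mulr_ge0; [exact: ltW|exact: normr_ge0].
apply: (@le_lt_trans _ _ (c * (k * `|phi|))).
  apply: norm_le_entries; first by apply: mulr_ge0; [exact: ltW|exact: kp0].
  by rewrite -(mul_scaled x tr); apply: hc; [exact: kp0|exact: (hk phi x x_traj t tr)].
by rewrite mulrA mulrC -ltr_pdivlMr.
Qed.

Lemma unforced_rhs_bounded (B : R) : 0 <= B -> exists2 L : R, 0 < L &
  forall x (t : R), entrywise_continuous (scaled x) ->
  (forall u, t0 - r <= u -> entries_le (scaled x u) B) -> t0 <= t ->
  entries_le (scaled_rhs P X V (scaled x t) (scaled x (t - r))
    (weighted_window r fc (scaled x) t) 0) L.
Proof.
move=> B0; have [cw cw0 hw] := weighted_window_le r_gt0 fc_cont (n := n).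
have [c1 c10 h1] := entries_le_mulmx (A1 P *m X + B1 P *m V).
have [c2 c20 h2] := entries_le_mulmx (A2 P *m X + B2 P *m V).
have [c3 c30 h3] := entries_le_mulmx
  (A3 P *m ((1%:M : 'M[R]_d) *t X) + B3 P *m ((1%:M : 'M[R]_d) *t V)).
exists (c1 * B + c2 * B + c3 * (cw * B) + 1) => [|x t cY YB tt0].
  apply: ltr_wpDl; last exact: ltr01.
  apply: addr_ge0; first by apply: addr_ge0; (apply: mulr_ge0; [exact: ltW|exact: B0]).
  by apply: mulr_ge0; [exact: ltW|apply: mulr_ge0; [exact: ltW|exact: B0]].
have tr := subr_le_trans r_gt0 tt0.
have trr : t0 - r <= t - r by rewrite lerD2r.
rewrite /scaled_rhs mulmx0 addr0.
have win : window_le r (scaled x) t B.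
  by move=> tau /andP[rtau _]; apply: YB; exact: lerD.
have wle := hw (scaled x) t B B0 cY win.
have cwB0 : 0 <= cw * B by apply: mulr_ge0; [exact: ltW|exact: B0].
have := entries_leD (entries_leD (h1 _ _ B0 (YB t tr)) (h2 _ _ B0 (YB _ trr)))
  (h3 _ _ cwB0 wle).
by apply: entries_leW; rewrite lerDl; exact: ler01.
Qed.

(** The functional decreases to its infimum. Were a coordinate of [x] at least
    [e] at some large time, it would, [x] being Lipschitz, be at least [e / 2]
    for a time [e / (2 L)] more, along which the functional would lose more
    than what separates it from its infimum. *)
Theorem closed_loop_attractive : globally_attractive r f P K t0.
Proof.
move=> phi x x_traj.
have [eps eps0 Th_le] := Theta_margin.
have [c c0 W_ge] := functional_lower.
have [k k0 hk] := scaled_bound.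
have cY := scaled_continuous x_traj.
have B0 : 0 <= k * `|phi| by apply: mulr_ge0; [exact: ltW|exact: normr_ge0].
have [L L0 hL] := unforced_rhs_bounded B0.
have rhsL (u : R) (tu : t0 <= u) := hL x u cY (hk phi x x_traj) tu.
have [C C0 hC] := dot_bounded (X^T *m X).
have x_le i (u : R) : t0 - r <= u ->
    x u i 0 ^+ 2 / C <= dot (scaled x u) (scaled x u).
  move=> ur; rewrite (ler_pdivrMr _ _ C0) mulrC; apply: le_trans (hC _).
  rewrite quad_formE -mulmxA dot_trmx (mul_scaled x ur); exact: coord_le_dot.
have dec a b e := @unforced_functional_decrease phi x x_traj eps a b e Th_le (ltW eps0).
pose E := [set W (scaled x) t | t in [set t | t0 <= t]].
have E_inf : has_inf E.
  split; first by exists (W (scaled x) t0); exists t0; [exact: lexx|].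
  exists 0 => _ [t _ <-]; apply: le_trans (W_ge _ t cY).
  by apply: mulr_ge0; [exact: ltW|exact: dot_ge0].
have inf_le (t : R) : t0 <= t -> inf E <= W (scaled x) t.
  by move=> tt0; apply: ge_inf; [case: E_inf|exists t].
apply/cvgr0Pnorm_le => e e0.
have e2_gt0 : 0 < e / 2 by apply: divr_gt0; [exact: e0|exact: ltr0Sn].
pose h := e / (2 * L); pose eta := eps * ((e / 2) ^+ 2 / C) * h.
have h0 : 0 < h.
  by apply: divr_gt0; [exact: e0|apply: mulr_gt0; [exact: ltr0Sn|exact: L0]].
have eta0 : 0 < eta.
  apply: mulr_gt0; last exact: h0.
  apply: mulr_gt0; first exact: eps0.
  apply: divr_gt0; last exact: C0.
  by apply: exprn_gt0; exact: e2_gt0.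
have [_ [T tT0 <-] WT_lt] := inf_adherent eta0 E_inf.
exists T; split; first exact: num_real.
move=> t Tt; apply: norm_le_entries; first exact: ltW.
have tt0 : t0 <= t by exact: ltW (le_lt_trans tT0 Tt).
move=> i; rewrite leNgt; apply/negP => e_lt.
have tth : t <= t + h by rewrite lerDl; exact: ltW h0.
have x_ge (u : R) : t <= u <= t + h -> e / 2 <= `|x u i 0|.
  move=> /andP[tu uh].
  have := @unforced_lipschitz phi x x_traj t u L i tt0 tu
    (fun v vtu => rhsL v (le_trans tt0 (proj1 (andP vtu)))).
  have Lh : L * (u - t) <= e / 2.
    have -> : e / 2 = L * h by rewrite /h; field; rewrite gt_eqF//; exact: L0.
    by rewrite (ler_pM2l L0) lerBlDl.
  have := ler_normB (x u i 0) (x u i 0 - x t i 0); rewrite subKr.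
  move: (`|x u i 0|) (`|x u i 0 - x t i 0|) e_lt Lh => a1 a2; lra.
have lose : W (scaled x) (t + h) <= W (scaled x) t - eta.
  have := dec t (t + h) ((e / 2) ^+ 2 / C) tt0 tth.
  rewrite [t + h - t]addrAC subrr add0r; apply => u tuh.
  have tu : t <= u by case/andP: tuh.
  apply: le_trans (x_le i u (subr_le_trans r_gt0 (le_trans tt0 tu))).
  have C'0 : 0 < C^-1 by rewrite invr_gt0.
  rewrite (ler_pM2r C'0); apply: sqr_le_of_le_norm (x_ge u tuh).
  exact: ltW e2_gt0.
have keep : W (scaled x) t <= W (scaled x) T.
  have := dec T t 0 tT0 (ltW Tt) (fun u _ => dot_ge0 _).
  by rewrite mulr0 mul0r subr0.
have := inf_le (t + h) (le_trans tt0 tth).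
move: WT_lt lose keep; move: (inf E) (W _ _) (W _ _) (W _ _) => ? ? ? ?.
lra.
Qed.

End closed_loop.

Theorem theorem3p2 (R : realType) (n m p q d : nat) (r t0 : R)
  (f : R -> 'cV[R]_d) (M : 'M[R]_d)
  (P : plant R n m p q d) (U : uncertainty R n m p q d) (s : supply_rate R m q)
  (r_gt0 : 0 < r)
  (f_ode : forall tau : R, tau \in `[- r, 0] ->
     has_derivative_on `[- r, 0] f tau (M *m f tau))
  (f_gram : posdef (gram r f))
  (Xi_gt0 : forall i, posdef (uXi U i))
  (Gamma_le0 : forall i, negsemidef (uGamma U i))
  (J1_sym : (J1 s)^T = J1 s) (J1_unit : J1 s \in unitmx)
  (J1_inv_lt0 : negdef (invmx (J1 s)))
  (J3_sym : (J3 s)^T = J3 s)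
  (alpha : 'I_(2 + d) -> R)
  (Pa X : 'M[R]_n) (V : 'M[R]_(p, n)) (Qa : 'M[R]_(n, d * n))
  (Ra : 'M[R]_(d * n)) (Sa Ua : 'M[R]_n) (k1 k2 : R)
  (Pa_sym : Pa^T = Pa) (X_unit : X \in unitmx) (Ra_sym : Ra^T = Ra)
  (Sa_sym : Sa^T = Sa) (Ua_sym : Ua^T = Ua)
  (k1_gt0 : 0 < k1) (k2_gt0 : 0 < k2)
  (PQRS_gt0 : lyapunov_lmi r f Pa Qa Ra Sa)
  (Sa_gt0 : posdef Sa) (Ua_gt0 : posdef Ua)
  (wp_lmi : well_posedness_lmi U k1)
  (mn_lmi : main_lmi r f M P U s alpha Pa X V Qa Ra Sa Ua k2) :
  let K := V *m invmx X in
  robustly (fun Delta : perturbation U =>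
    dissipative r f (perturb P Delta) K t0 s) /\
  robustly (fun Delta : perturbation U =>
    globally_asymptotically_stable r f (perturb P Delta) K t0).
Proof.
move=> K; split=> Delta Delta_adm;
  have wp := admissible_well_posed k1_gt0 Xi_gt0 wp_lmi Delta_adm;
  have Theta_lt0 := admissible_Theta_negdef k1_gt0 k2_gt0 Xi_gt0 wp_lmi mn_lmi
    Delta_adm; split; [exact: wp| |exact: wp|].
  exact: (closed_loop_dissipative t0 r_gt0 f_ode f_gram J1_unit Pa_sym X_unit
    Ra_sym Sa_sym Ua_sym PQRS_gt0 Sa_gt0 Ua_gt0 Theta_lt0).
split.
  exact: (closed_loop_stable t0 r_gt0 f_ode f_gram J1_unit J1_inv_lt0 Pa_sym X_unit
    Ra_sym PQRS_gt0 Sa_gt0 Ua_gt0 Theta_lt0).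
exact: (closed_loop_attractive r_gt0 f_ode f_gram J1_unit J1_inv_lt0 Pa_sym
  X_unit Ra_sym PQRS_gt0 Sa_gt0 Ua_gt0 Theta_lt0).
Qed.
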